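(* Let $D$ be a rank $k$ partial flag positroid pipe dream whose pivot columns satisfy $u_i<u_{i+1}$ for some $1\le i\le k-1$, and let $D'=\mathrm{st}_i(D)$. Then $\mathcal B(D)=\mathcal B(D')$.
   Context: Pipe dreams: for $u\in\mathfrak S_n$ use an $n\times n$ array, box $(i,j)$ in row $i$ from the top, column $j$ from the left, tiled by: empty; horizontal pipe; vertical pipe; pivot elbow (one arc from top-edge midpoint to right-edge midpoint); cross; elbow (two arcs: top to right, and left to bottom). A Rothe pipe dream of $u$: (i) $n$ pipes each from the top edge to the right edge; (ii) $(i,u_i)$ is a pivot elbow; (iii) boxes $(i,j)$ with $u^{-1}(j)<i$, $j<u_i$ empty; (iv) boxes with $u^{-1}(j)<i$, $j>u_i$ horizontal pipes; (v) boxes with $u^{-1}(j)>i$, $j<u_i$ vertical pipes; remaining boxes crosses or elbows. Reduced: no two pipes cross twice. Exit permutation $v$: $v_i$ = label (starting column) of the pipe leaving the right edge in row $i$. Pipes touch if they share an elbow tile. A flag positroid pipe dream $\mathrm{FPP}(u,v)$ is a reduced Rothe pipe dream of $u$ with exit permutation $v$ in which two pipes that cross never touch southeast of their crossing. A rank $k$ partial flag positroid pipe dream is the restriction of some $n\times n$ flag positroid pipe dream to its first $k$ rows; its pivot columns are $u_1,\dots,u_k$. Directed graph $G(D)$: a source $s_{u_i}$ at each pivot elbow $(i,u_i)$, a vertex at each (non-pivot) elbow tile, and a sink $t_j$ above each column $j$; each non-sink vertex has an edge to the nearest vertex above it in its column (or to $t_j$ if none); each non-source vertex has an edge into it from the nearest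 vertex to its left in its row. An admissible $k$-collection is a set of $k$ pairwise vertex-disjoint directed paths each from a source to a sink; $\mathcal B(D)$ is the set of $J\subseteq[n]$, $|J|=k$, that are the sink sets $\{j: t_j\text{ is an endpoint}\}$ of admissible $k$-collections. Standardization $\mathrm{st}_i$ ($u_i<u_{i+1}$): with $D_{i,j}$ the tile in box $(i,j)$, let $j^*$ be the smallest $j\ge u_{i+1}$ with $D_{i,j}$ a cross and $D_{i+1,j}$ an elbow or pivot elbow ($j^*=\infty$ if none); $\mathrm{st}_i(D)$ is obtained by exchanging the tiles of rows $i$ and $i+1$ in all columns $j$ with $j\le u_{i+1}$ or $j\ge j^*$, then replacing box $(i,u_i)$ by a vertical pipe, box $(i+1,u_{i+1})$ by a horizontal pipe, and, if $u_{i+1}<j^*\le n$, box $(i+1,j^* )$ by an elbow; all other tiles unchanged. *)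

(* Defs.v *)
From HB Require Import structures.
From mathcomp Require Import all_boot all_fingroup all_algebra.
From mathcomp Require Import classical_sets.

Set Implicit Arguments.
Unset Strict Implicit.
Unset Printing Implicit Defensive.

(* Rows and columns are numbered from 0. *)

Inductive tile := Empty | Horizontal | Vertical | Pivot | Cross | Elbow.

Lemma tile_eq_dec : comparable tile.
Proof. by move=> x y; rewrite /decidable; decide equality. Qed.

HB.instance Definition _ := hasDecEq.Build tile (compareP tile_eq_dec).

Inductive entry := FromTop | FromLeft.
Inductive exit := ToRight | ToBottom.

Definition route (T : tile) (e : entry) : option exit :=
  match T, e with
  | Horizontal, FromLeft => Some ToRight
  | Vertical, FromTop => Some ToBottom
  | Pivot, FromTop => Some ToRight
  | Cross, FromLeft => Some ToRight
  | Cross, FromTop => Some ToBottom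
  | Elbow, FromTop => Some ToRight
  | Elbow, FromLeft => Some ToBottom
  | _, _ => None
  end.

(* [enters E p i j e]: the pipe starting at the top edge of column p enters
   box (i, j) through the side e. *)
Inductive enters (n : nat) (E : 'M[tile]_n) (p : 'I_n) :
    'I_n -> 'I_n -> entry -> Prop :=
| enters_start (i : 'I_n) of i = 0 :> nat : enters E p i p FromTop
| enters_right (i j j' : 'I_n) (e : entry) of
    enters E p i j e & route (E i j) e = Some ToRight & j' = j.+1 :> nat :
    enters E p i j' FromLeft
| enters_down (i i' j : 'I_n) (e : entry) of
    enters E p i j e & route (E i j) e = Some ToBottom & i' = i.+1 :> nat :
    enters E p i' j FromTop.

Definition exits (n : nat) (E : 'M[tile]_n) (p i : 'I_n) : Prop :=
  exists (j : 'I_n) (e : entry),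
    [/\ enters E p i j e, route (E i j) e = Some ToRight & j.+1 = n].

Definition visits (n : nat) (E : 'M[tile]_n) (p i j : 'I_n) : Prop :=
  exists e : entry, enters E p i j e.

Definition cross_at (n : nat) (E : 'M[tile]_n) (p q i j : 'I_n) : Prop :=
  [/\ p != q, visits E p i j, visits E q i j & E i j = Cross].

Definition touch_at (n : nat) (E : 'M[tile]_n) (p q i j : 'I_n) : Prop :=
  [/\ p != q, visits E p i j, visits E q i j & E i j = Elbow].

Record rothe (n : nat) (u : 'S_n) (E : 'M[tile]_n) : Prop := Rothe {
  rothe_pipes : forall p : 'I_n, exists i : 'I_n, exits E p i;
  rothe_pivot : forall i : 'I_n, E i (u i) = Pivot;
  rothe_empty : forall i j : 'I_n,
    (u^-1)%g j < i -> j < u i -> E i j = Empty;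
  rothe_horizontal : forall i j : 'I_n,
    (u^-1)%g j < i -> u i < j -> E i j = Horizontal;
  rothe_vertical : forall i j : 'I_n,
    i < (u^-1)%g j -> j < u i -> E i j = Vertical;
  rothe_other : forall i j : 'I_n,
    i < (u^-1)%g j -> u i < j -> E i j = Cross \/ E i j = Elbow
}.

Definition reduced (n : nat) (E : 'M[tile]_n) : Prop :=
  forall p q i j i' j' : 'I_n,
    cross_at E p q i j -> cross_at E p q i' j' -> i = i' /\ j = j'.

Definition exit_perm (n : nat) (E : 'M[tile]_n) (v : 'S_n) : Prop :=
  forall i : 'I_n, exits E (v i) i.

Record fpp (n : nat) (u v : 'S_n) (E : 'M[tile]_n) : Prop := Fpp {
  fpp_rothe : rothe u E;
  fpp_reduced : reduced E;
  fpp_exit : exit_perm E v;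
  fpp_touch : forall p q i j i' j' : 'I_n,
    cross_at E p q i j -> touch_at E p q i' j' -> ~ (i <= i' /\ j <= j')
}.

Definition partial_fpp (n k : nat) (D : 'M[tile]_(k, n)) : Prop :=
  exists (u v : 'S_n) (E : 'M[tile]_n) (le_kn : k <= n),
    fpp u v E /\ D = rowsub (widen_ord le_kn) E.

Definition pivot_columns (n k : nat) (D : 'M[tile]_(k, n))
    (u : 'I_k -> 'I_n) : Prop :=
  forall (i : 'I_k) (j : 'I_n), D i j = Pivot <-> j = u i.

(* [inl (i, j)] is the box (i, j) and [inr j] is the sink t_j; only the boxes
   satisfying [node] below are vertices of the graph. *)
Definition vertex (n k : nat) : finType := (('I_k * 'I_n) + 'I_n)%type.

Definition node (n k : nat) (D : 'M[tile]_(k, n)) (i : 'I_k) (j : 'I_n) : bool :=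
  D i j \in [:: Pivot; Elbow].

Definition edge (n k : nat) (D : 'M[tile]_(k, n)) : rel (vertex n k) :=
  fun x y => match x, y with
  | inl (i, j), inl (i', j') =>
      [&& node D i j, node D i' j' &
        [&& j == j', i' < i &
            [forall a : 'I_k, (i' < a < i) ==> ~~ node D a j]]
        || [&& i == i', j < j', D i' j' != Pivot &
            [forall b : 'I_n, (j < b < j') ==> ~~ node D i b]]]
  | inl (i, j), inr j' =>
      [&& node D i j, j == j' &
          [forall a : 'I_k, (a < i) ==> ~~ node D a j]]
  | inr _, _ => false
  end.

(* The a-th path starts at the source in box [s a], continues through the
   vertices [P a] and ends at the sink [t a]. *)
Definition admissible (n k : nat) (D : 'M[tile]_(k, n))
    (s : 'I_k -> 'I_k * 'I_n) (P : 'I_k -> seq (vertex n k))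
    (t : 'I_k -> 'I_n) : Prop :=
  (forall a : 'I_k,
     [/\ D (s a).1 (s a).2 = Pivot,
         path (edge D) (inl (s a)) (P a) &
         last (inl (s a)) (P a) = inr (t a)]) /\
  (forall a b : 'I_k, a != b ->
     [disjoint (inl (s a) : vertex n k) :: P a
             & (inl (s b) : vertex n k) :: P b]).

Definition sink_sets (n k : nat) (D : 'M[tile]_(k, n)) : set {set 'I_n} :=
  [set J : {set 'I_n} | #|J| = k /\
     exists (s : 'I_k -> 'I_k * 'I_n) (P : 'I_k -> seq (vertex n k))
            (t : 'I_k -> 'I_n),
       admissible D s P t /\ J = [set t a | a in 'I_k]%SET ]%classic.

(* j^*, with infinity encoded as n. *)
Definition jstar (n k : nat) (u : 'I_k -> 'I_n) (i i' : 'I_k)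
    (D : 'M[tile]_(k, n)) : nat :=
  find (fun j : 'I_n =>
          [&& u i' <= j, D i j == Cross & D i' j \in [:: Elbow; Pivot]])
       (enum 'I_n).

(* st_i(D), where u gives the pivot columns of D and i' is the row i + 1. *)
Definition st (n k : nat) (u : 'I_k -> 'I_n) (i i' : 'I_k)
    (D : 'M[tile]_(k, n)) : 'M[tile]_(k, n) :=
  let js := jstar u i i' D in
  \matrix_(a < k, j < n)
    if (a == i) && (j == u i) then Vertical
    else if (a == i') && (j == u i') then Horizontal
    else if [&& a == i', j == js :> nat & u i' < js] then Elbow
    else if (j <= u i') || (js <= j) then D (tperm i i' a) j
    else D a j.

(* Main.v *)
Require Import Defs.
From mathcomp Require Import all_boot all_fingroup all_algebra.
From mathcomp Require Import classical_sets.
From mathcomp Require Import boolp.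
From mathcomp Require Import zify.

(* Cutting an admissible collection along the horizontal grid lines gives sets
   [V r] of columns in which some path crosses the top of row [r], and
   consecutive sets are related by a local rule which is scanned along the row
   with one bit, the horizontal flow.  Since only the occupied columns matter,
   and standardization changes only rows i and i+1, it suffices to compare the
   two-row relations of D and st_i(D) column by column, with two bits of state
   (lower row, upper row).  The scans can be matched except that, between
   u_{i+1} and j^*, D may hold its flow in the lower row where st_i(D) holds it
   in the upper one.  This is harmless as soon as the set S of columns entering
   from below satisfies: if the pipes in columns y < z have crossed, then y in S
   implies z in S.  That property is proved by induction on the rows from below;
   the only input from the pipe dream is that at every cross or elbow the pipe
   coming from the left has a smaller label than the pipe coming from the top. *)

Set Implicit Arguments.
Unset Strict Implicit.
Unset Printing Implicit Defensive.

(** * Row transfer *)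

Definition is_node (T : tile) : bool :=
  match T with Pivot | Elbow => true | _ => false end.

Lemma is_nodeE T : (T \in [:: Pivot; Elbow]) = is_node T.
Proof. by rewrite !inE; case: T => /=; do 2?case: eqP. Qed.

(* [s], [h], [t], [h'] tell whether a path crosses the bottom, left, top, right
   edge of the box; a pivot emits one path. *)
Definition step (T : tile) (s h t h' : bool) : bool :=
  match T with
  | Pivot => (s + h + 1 == t + h')%N && (t + h' <= 1)%N
  | Elbow => (s + h == t + h')%N && (t + h' <= 1)%N
  | _ => (t == s) && (h' == h)
  end.

Lemma stepE T s h t h' : step T s h t h' =
  if T \in [:: Pivot; Elbow]
  then (s + h + (T == Pivot) == t + h')%N && (t + h' <= 1)%N
  else (t == s) && (h' == h).
Proof.
rewrite is_nodeE; case: T => //=; first by rewrite eqxx.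
by rewrite (_ : (Elbow == Pivot) = false) ?addn0 //; apply/eqP.
Qed.

Lemma step_nonnode T s h t h' : ~~ is_node T ->
  step T s h t h' -> t = s /\ h' = h.
Proof. by case: T => //= _ /andP[/eqP-> /eqP->]. Qed.

Definition row_flow (n : nat) (w : 'I_n -> tile) (S T : nat -> bool) : Prop :=
  exists h : nat -> bool, [/\ h 0 = false, h n = false &
    forall j : 'I_n, step (w j) (S j) (h j) (T j) (h j.+1)].

Definition flow (n k : nat) (D : 'M[tile]_(k, n)) (J : {set 'I_n}) : Prop :=
  exists V : nat -> nat -> bool,
    [/\ forall j, V k j = false,
        forall r : 'I_k, row_flow (D r) (V r.+1) (V r)
      & J = [set j : 'I_n | V 0 j]%SET].

Section PathsToFlow.

Variables (n k : nat) (D : 'M[tile]_(k, n)) (u : 'I_k -> 'I_n).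
Hypothesis pivD : pivot_columns D u.
Variables (s : 'I_k -> 'I_k * 'I_n) (P : 'I_k -> seq (vertex n k)).
Variable t : 'I_k -> 'I_n.
Hypothesis admP : admissible D s P t.

Let Q a : seq (vertex n k) := inl (s a) :: P a.

Definition vrank (x : vertex n k) : nat :=
  if x is inl (r, j) then (r + (n - j)).+1 else 0.

Lemma edge_vrank x y : edge D x y -> vrank y < vrank x.
Proof.
case: x => [[r j]|j] //; case: y => [[r' j']|j'] //=.
case/and3P=> _ _ /orP[/and3P[/eqP-> lt_r _]|/and4P[/eqP-> lt_j _ _]].
  by have := ltn_ord j'; lia.
by have := ltn_ord j'; lia.
Qed.

Let z0 a : vertex n k := inl (s a).

Lemma path_occ a m b l :
  m <= size (P a) -> l <= size (P b) ->
  nth (z0 a) (Q a) m = nth (z0 b) (Q b) l -> a = b /\ m = l.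
Proof.
move=> lem lel eqx.
have eqab : a = b.
  apply/eqP/negPn/negP=> /(proj2 admP) /disjointFr/(_ (mem_nth (z0 a) _)).
  move=> /(_ m); rewrite ltnS => /(_ lem); rewrite eqx.
  by rewrite mem_nth.
split=> //; subst b.
have [_ pthP _] := proj1 admP a.
have Quniq : uniq (Q a).
  apply: (@sorted_uniq _ (fun x y => vrank y < vrank x)).
  - by move=> y x z /= lt1 lt2; apply: ltn_trans lt2 lt1.
  - by move=> x /=; rewrite ltnn.
  by apply: sub_path pthP => x y; apply: edge_vrank.
by apply/eqP; move/eqP: eqx; rewrite nth_uniq.
Qed.

Definition used (x y : vertex n k) : Prop :=
  exists a m, [/\ m < size (P a), nth (z0 a) (Q a) m = x
                & nth (z0 a) (Q a) m.+1 = y].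

Definition visited (x : vertex n k) : Prop :=
  exists a m, m <= size (P a) /\ nth (z0 a) (Q a) m = x.

Lemma used_edge x y : used x y -> edge D x y.
Proof.
case=> a [m [ltm <- <-]]; have [_ pthP _] := proj1 admP a.
by move/(pathP (z0 a)): pthP; apply.
Qed.

Lemma used_fun x y y' : used x y -> used x y' -> y = y'.
Proof.
case=> a [m [ltm xE <-]] [b [l [ltl xE' <-]]].
have [] := @path_occ a m b l (ltnW ltm) (ltnW ltl); first by rewrite xE.
by move=> <- <-.
Qed.

Lemma used_inj x x' y : used x y -> used x' y -> x = x'.
Proof.
case=> a [m [ltm <- yE]] [b [l [ltl <- yE']]].
by have [|<- [<-]] := @path_occ a m.+1 b l.+1 ltm ltl; first by rewrite yE.
Qed.

Lemma used_visited x y : used x y -> visited x /\ visited y.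
Proof.
case=> a [m [ltm xE yE]]; split; [exists a, m | exists a, m.+1] => //.
by split=> //; apply: ltnW.
Qed.

Lemma visited_out v : visited (inl v) -> exists y, used (inl v) y.
Proof.
case=> a [m [lem xE]]; exists (nth (z0 a) (Q a) m.+1); exists a, m; split=> //.
rewrite ltn_neqAle lem andbT; apply/eqP=> eqm; have [_ _] := proj1 admP a.
by rewrite (last_nth (z0 a)) -eqm [nth _ _ _]xE.
Qed.

Lemma visited_in x : visited x ->
  (exists y, used y x) \/ (exists a, x = inl (s a)).
Proof.
case=> a [[|m] [lem xE]]; first by right; exists a.
by left; exists (nth (z0 a) (Q a) m), a, m.
Qed.

Lemma start_not_in a x : ~ used x (inl (s a)).
Proof.
case=> b [m [ltm _ yE]].
by have [|_] := @path_occ b m.+1 a 0 ltm isT; first by rewrite yE.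
Qed.

Lemma start_visited a : visited (inl (s a)).
Proof. by exists a, 0. Qed.

Lemma start_pivot a : D (s a).1 (s a).2 = Pivot.
Proof. by have [] := proj1 admP a. Qed.

Lemma pivot_start r j : D r j = Pivot -> exists a, s a = (r, j).
Proof.
move=> /pivD ->.
have s2 a : (s a).2 = u (s a).1 by apply/pivD/start_pivot.
have injs : injective (fun a => (s a).1).
  move=> a b eqs.
  have eqsab : s a = s b.
    by rewrite [s a]surjective_pairing [s b]surjective_pairing !s2 eqs.
  by have [] := @path_occ a 0 b 0 isT isT; first by rewrite /= /z0 eqsab.
have [f _ fK] := injF_bij injs.
by exists (f r); rewrite [s _]surjective_pairing s2 fK.
Qed.

Definition vflow (r j : nat) : bool :=
  `[< exists (r1 : 'I_k) (c : 'I_n) (y : vertex n k),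
        [/\ c = j :> nat, r <= r1, used (inl (r1, c)) y &
            if y is inl (r2, c') then (c' == c) && (r2 < r) else true] >].

Definition hflow (r j : nat) : bool :=
  `[< exists (r0 : 'I_k) (c1 c2 : 'I_n),
        [/\ r0 = r :> nat, c1 < j <= c2 & used (inl (r0, c1)) (inl (r0, c2))] >].

Lemma vflowP (r : 'I_k) (j : 'I_n) : node D r j ->
  reflect (exists2 y, used (inl (r, j)) y &
             if y is inl (r2, c') then c' == j else true) (vflow r j).
Proof.
move=> nrj; apply: (iffP (asboolP _)).
  case=> r1 [c [y [/val_inj-> le_r uy yP]]]; exists y; last first.
    by case: y yP {uy} => [[r2 c']|//] /andP[].
  have [<-//|ner] := eqVneq r1 r.
  have ltr : r < r1 by rewrite ltn_neqAle le_r eq_sym (inj_eq val_inj) ner.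
  have /= := used_edge uy; case: y yP uy => [[r2 c']|c'] /=.
    case/andP=> /eqP-> lt2 _; rewrite eqxx /= => /and3P[_ _ /orP[|]].
      by case/andP=> _ /forallP/(_ r); rewrite lt2 ltr nrj.
    by rewrite ltnn andbF.
  by move=> _ _ /and3P[_ _ /forallP/(_ r)]; rewrite ltr nrj.
case=> y uy yP; exists r, j, y; split=> //.
have /= := used_edge uy; case: y yP uy => [[r2 c']|//] /eqP-> _.
by rewrite eqxx ltnn andbF orbF /= => /and4P[].
Qed.

Lemma vflow_inP (r : 'I_k) (j : 'I_n) : node D r j ->
  reflect (exists r1, used (inl (r1, j)) (inl (r, j))) (vflow r.+1 j).
Proof.
move=> nrj; apply: (iffP (asboolP _)).
  case=> r1 [c [y [/val_inj-> ltr uy yP]]]; exists r1.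
  have /= := used_edge uy; case: y yP uy => [[r2 c']|c'] /=.
    case/andP=> /eqP->; rewrite ltnS leq_eqVlt => /orP[/eqP/val_inj->//|lt2] _.
    rewrite eqxx /= => /and3P[_ _ /orP[|]].
      by case/andP=> _ /forallP/(_ r); rewrite lt2 ltr nrj.
    by rewrite ltnn andbF.
  by move=> _ _ /and3P[_ _ /forallP/(_ r)]; rewrite ltr nrj.
case=> r1 ur; exists r1, j, (inl (r, j)); split=> //.
  have /= := used_edge ur; rewrite eqxx ltnn andbF orbF /=.
  by case/and4P.
by rewrite eqxx /=.
Qed.

Lemma hflowP (r : 'I_k) (j : 'I_n) : node D r j ->
  reflect (exists2 c : 'I_n, j < c & used (inl (r, j)) (inl (r, c)))
          (hflow r j.+1).
Proof.
move=> nrj; apply: (iffP (asboolP _)).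
  case=> r0 [c1 [c2 [/val_inj-> /andP[le1 lt2] uc]]]; exists c2 => //.
  move: le1; rewrite ltnS leq_eqVlt => /orP[/eqP/val_inj<-//|lt1].
  have /= := used_edge uc; rewrite eqxx ltnn andbF /= => /and3P[_ _].
  by case/and3P=> _ _ /forallP/(_ j); rewrite lt1 lt2 nrj.
by case=> c ltc uc; exists r, j, c; rewrite ltnSn.
Qed.

Lemma hflow_inP (r : 'I_k) (j : 'I_n) : node D r j ->
  reflect (exists2 c : 'I_n, c < j & used (inl (r, c)) (inl (r, j)))
          (hflow r j).
Proof.
move=> nrj; apply: (iffP (asboolP _)).
  case=> r0 [c1 [c2 [/val_inj-> /andP[lt1 le2] uc]]]; exists c1 => //.
  move: le2; rewrite leq_eqVlt => /orP[/eqP/val_inj->//|lt2].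
  have /= := used_edge uc; rewrite eqxx ltnn andbF /= => /and3P[_ _].
  by case/and3P=> _ _ /forallP/(_ j); rewrite lt1 lt2 nrj.
by case=> c ltc uc; exists r, c, j; rewrite ltc leqnn.
Qed.

Lemma flow_step (r : 'I_k) (j : 'I_n) :
  step (D r j) (vflow r.+1 j) (hflow r j) (vflow r j) (hflow r j.+1).
Proof.
rewrite stepE; case: ifP => [nrj|nrj]; last first.
  have nonode r0 : used r0 (inl (r, j)) -> False.
    by move/used_edge; case: r0 => [[r1 j1]|//]; rewrite /edge /node nrj andbF.
  have nonode' y : used (inl (r, j)) y -> False.
    by move/used_edge; rewrite /edge /node nrj; case: y => [[]|].
  apply/andP; split; apply/eqP; apply/idP/idP.
  - case/asboolP=> r1 [c [y [cE ler uy yP]]]; apply/asboolP; exists r1, c, y.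
    split=> //.
      rewrite ltn_neqAle ler andbT; apply/eqP=> /val_inj er.
      by move: uy; rewrite -er; move/val_inj: cE => -> /nonode'.
    by case: y yP {uy} => [[r2 c']|//] /andP[-> /ltnW].
  - case/asboolP=> r1 [c [y [cE ler uy yP]]]; apply/asboolP; exists r1, c, y.
    split=> //; first exact: ltnW.
    case: y yP uy => [[r2 c']|//] /andP[/eqP-> ler2] uy.
    rewrite eqxx ltn_neqAle -ltnS ler2 andbT; apply/eqP=> /val_inj er.
    by move: uy; rewrite er; move/val_inj: cE => -> /nonode.
  - case/asboolP=> r0 [c1 [c2 [rE /andP[lt1 lt2] uc]]]; apply/asboolP.
    exists r0, c1, c2; split=> //; rewrite (ltnW lt2) andbT.
    rewrite ltn_neqAle -ltnS lt1 andbT; apply/eqP=> /val_inj ec.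
    by move: uc; rewrite ec; move/val_inj: rE => -> /nonode'.
  case/asboolP=> r0 [c1 [c2 [rE /andP[lt1 lt2] uc]]]; apply/asboolP.
  exists r0, c1, c2; split=> //; rewrite ltnS (ltnW lt1) /=.
  rewrite ltn_neqAle lt2 andbT; apply/eqP=> /val_inj ec.
  by move: uc; rewrite -ec; move/val_inj: rE => -> /nonode.
have outE : (vflow r j + hflow r j.+1)%N = `[< visited (inl (r, j)) >].
  case: (vflowP nrj) => [[y uy yP]|nv]; case: (hflowP nrj) => [[c ltc uc]|nh].
  - by move: yP ltc; rewrite (used_fun uy uc) => /eqP->; rewrite ltnn.
  - by case: asboolP => // -[]; case: (used_visited uy).
  - by case: asboolP => // -[]; case: (used_visited uc).
  case: asboolP => // /visited_out[y uy]; have /= := used_edge uy.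
  case: y uy => [[r2 c]|c] uy; last by case: nv; exists (inr c).
  case/and3P=> _ _ /orP[/and3P[/eqP ec _ _]|/and4P[/eqP er ltc _ _]].
    by case: nv; exists (inl (r2, c)); rewrite // -ec.
  by case: nh; exists c; rewrite // [in X in used _ X]er.
have inE : (vflow r.+1 j + hflow r j + (D r j == Pivot))%N =
           `[< visited (inl (r, j)) >].
  have notin a : D r j = Pivot -> used a (inl (r, j)) -> False.
    by case/pivot_start=> b <- /start_not_in.
  case: (vflow_inP nrj) => [[r1 uv]|nv]; case: (hflow_inP nrj) => [[c ltc uc]|nh].
  - by move: ltc; have [_ ->] := used_inj uv uc; rewrite ltnn.
  - case: eqP => [/notin/(_ uv)//|_].
    by case: asboolP => // -[]; case: (used_visited uv).
  - case: eqP => [/notin/(_ uc)//|_].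
    by case: asboolP => // -[]; case: (used_visited uc).
  case: eqP => [/pivot_start[a sa]|np].
    by rewrite -sa asboolT //; apply: start_visited.
  case: asboolP => // /visited_in[[y uy]|[a [sa]]]; last first.
    by case: np; have := start_pivot a; rewrite -sa.
  have /= := used_edge uy; case: y uy => [[r2 c]|//] uy.
  case/and3P=> _ _ /orP[/and3P[/eqP ec _ _]|/and4P[/eqP er ltc _ _]].
    by case: nv; exists r2; rewrite -[in X in used X _]ec.
  by case: nh; exists c; rewrite // -[in X in used X _]er.
by rewrite inE outE eqxx; case: `[< _ >].
Qed.

Lemma vflow0 (j : 'I_n) : vflow 0 j = (j \in [set t a | a in 'I_k]%SET).
Proof.
apply/asboolP/imsetP.
  case=> r1 [c [y [/val_inj-> _ uy yP]]].
  have yE : y = inr j.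
    have /= := used_edge uy; case: y uy yP => [[r2 c']|c'] uy; first by rewrite andbF.
    by move=> _ /and3P[_ /eqP->].
  move: uy; rewrite {y yP}yE => -[a [m [ltm _ mE]]]; exists a => //.
  have [_ /(pathP (z0 a)) pthP] := proj1 admP a.
  rewrite (last_nth (z0 a)).
  have [->|ne] := eqVneq (size (P a)) m.+1; first by rewrite -/(Q a) mE => -[].
  by have /pthP : m.+1 < size (P a) by [lia]; rewrite -/(Q a) mE.
case=> a _ ->; have [_ pthP lastP] := proj1 admP a.
have szP : size (P a) > 0 by case: (P a) lastP.
have ut : used (nth (z0 a) (Q a) (size (P a)).-1) (inr (t a)).
  exists a, (size (P a)).-1; rewrite prednK //; split=> //.
  by rewrite -lastP (last_nth (z0 a)).
have /= := used_edge ut; case xE: (nth _ _ _) => [[r c]|//] /and3P[_ /eqP ec _].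
by exists r, c, (inr (t a)); rewrite -xE ec.
Qed.

Lemma admissible_flow : flow D [set t a | a in 'I_k]%SET.
Proof.
exists vflow; split.
- by move=> j; apply/asboolP=> -[r1 [c [y [_]]]]; rewrite leqNgt ltn_ord.
- move=> r; exists (hflow r); split.
  + by apply/asboolP=> -[r0 [c1 [c2 []]]].
  + by apply/asboolP=> -[r0 [c1 [c2 [_ /andP[_]]]]]; rewrite leqNgt ltn_ord.
  exact: flow_step.
by apply/setP=> j; rewrite inE vflow0.
Qed.

End PathsToFlow.

Section FlowToPaths.

Variables (n k : nat) (D : 'M[tile]_(k, n)) (u : 'I_k -> 'I_n).
Hypothesis pivD : pivot_columns D u.
Variables (V : nat -> nat -> bool) (h : 'I_k -> nat -> bool).
Hypothesis Vk : forall j, V k j = false.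
Hypothesis h0 : forall r, h r 0 = false.
Hypothesis hn : forall r, h r n = false.
Hypothesis hstep : forall (r : 'I_k) (j : 'I_n),
  step (D r j) (V r.+1 j) (h r j) (V r j) (h r j.+1).

Lemma vertical_skip (j : 'I_n) lo hi : lo <= hi -> hi <= k ->
  (forall a : 'I_k, lo <= a < hi -> ~~ node D a j) -> V lo j = V hi j.
Proof.
elim: hi => [|hi IH]; first by rewrite leqn0 => /eqP->.
rewrite leq_eqVlt => /orP[/eqP->//|lelo] ltk nonode.
have /negbTE nn : ~~ node D (Ordinal ltk) j by apply: nonode; rewrite /= ltnSn andbT.
have := hstep (Ordinal ltk) j; rewrite stepE [_ \in _]nn => /andP[/eqP <- _].
apply: IH => //; first exact: ltnW.
by move=> a /andP[lea lta]; apply: nonode; rewrite lea ltnW.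
Qed.

Lemma horizontal_skip (r : 'I_k) lo hi : lo <= hi -> hi <= n ->
  (forall b : 'I_n, lo <= b < hi -> ~~ node D r b) -> h r lo = h r hi.
Proof.
elim: hi => [|hi IH]; first by rewrite leqn0 => /eqP->.
rewrite leq_eqVlt => /orP[/eqP->//|lelo] ltn nonode.
have /negbTE nn : ~~ node D r (Ordinal ltn) by apply: nonode; rewrite /= ltnSn andbT.
have := hstep r (Ordinal ltn); rewrite stepE [_ \in _]nn => /andP[_ /eqP ->].
apply: IH => //; first exact: ltnW.
by move=> b /andP[leb ltb]; apply: nonode; rewrite leb ltnW.
Qed.

Lemma node_step (r : 'I_k) (j : 'I_n) : node D r j ->
  (V r.+1 j + h r j + (D r j == Pivot) = V r j + h r j.+1 /\
   V r j + h r j.+1 <= 1)%N.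
Proof. by move=> nrj; have := hstep r j; rewrite stepE [_ \in _]nrj => /andP[/eqP]. Qed.

(* Edges selected by the flow; each vertex has at most one predecessor, which
   makes the traced paths disjoint. *)
Definition follows (x y : vertex n k) : bool :=
  edge D x y && match x, y with
  | inl (r, j), inl (r', j') => if j' == j then V r j else h r j.+1
  | inl (r, j), inr _ => V r j
  | _, _ => false
  end.

Lemma follows_node x (r : 'I_k) (j : 'I_n) : follows x (inl (r, j)) ->
  node D r j /\
  ((V r.+1 j /\ exists r1, [/\ x = inl (r1, j), r < r1, node D r1 j
       & [forall a : 'I_k, (r < a < r1) ==> ~~ node D a j]])
   \/ (h r j /\ exists c, [/\ x = inl (r, c), c < j, node D r c
       & [forall b : 'I_n, (c < b < j) ==> ~~ node D r b]])).
Proof.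
case: x => [[r1 c]|//]; rewrite /follows /= => /andP[/and3P[nx ny]].
case/orP=> [/and3P[/eqP ec ltr noa]|/and4P[/eqP er ltc _ nob]].
  rewrite ec eqxx in nx noa * => Vr; split=> //; left; split; last by exists r1.
  rewrite (@vertical_skip _ _ r1) // 1?ltnW // => a.
  exact/implyP/(forallP noa).
rewrite er in nx nob *.
rewrite -val_eqE gtn_eqF // => hr; split=> //; right; split; last by exists c.
rewrite -(@horizontal_skip r c.+1) // 1?ltnW // => b.
exact/implyP/(forallP nob).
Qed.

Lemma follows_sink x (j : 'I_n) : follows x (inr j) ->
  V 0 j /\ exists r1, [/\ x = inl (r1, j), node D r1 j
       & [forall a : 'I_k, (a < r1) ==> ~~ node D a j]].
Proof.
case: x => [[r1 c]|//]; rewrite /follows /= => /andP[/and3P[nx /eqP ec noa]].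
rewrite ec in nx noa * => Vr; split; last by exists r1.
rewrite (@vertical_skip _ _ r1) // 1?ltnW // => a /=.
exact/implyP/(forallP noa).
Qed.

Lemma follows_inj x x' y : follows x y -> follows x' y -> x = x'.
Proof.
case: y => [[r j]|j]; last first.
  move=> /follows_sink[_ [r1 [-> n1 no1]]] /follows_sink[_ [r2 [-> n2 no2]]].
  have [lt12|lt21|/val_inj->//] := ltngtP r1 r2.
    by have /forallP/(_ r1) := no2; rewrite lt12 n1.
  by have /forallP/(_ r2) := no1; rewrite lt21 n2.
move=> /follows_node[nj in1] /follows_node[_ in2]; have [inE le1] := node_step nj.
case: in1 in2 => [[V1 [r1 [-> lt1 n1 no1]]]|[h1 [c1 [-> lt1 n1 no1]]]]
  [[V2 [r2 [-> lt2 n2 no2]]]|[h2 [c2 [-> lt2 n2 no2]]]].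
- have [lt12|lt21|/val_inj->//] := ltngtP r1 r2.
    by have /forallP/(_ r1) := no2; rewrite lt12 lt1 n1.
  by have /forallP/(_ r2) := no1; rewrite lt21 lt2 n2.
- by move: le1; rewrite -inE V1 h2.
- by move: le1; rewrite -inE V2 h1.
have [lt12|lt21|/val_inj->//] := ltngtP c1 c2.
  by have /forallP/(_ c2) := no1; rewrite lt12 lt2 n2.
by have /forallP/(_ c1) := no2; rewrite lt21 lt1 n1.
Qed.

Lemma no_follows_pivot x (r : 'I_k) (j : 'I_n) :
  D r j = Pivot -> ~ follows x (inl (r, j)).
Proof.
move=> pj /follows_node[nj in1]; have [inE le1] := node_step nj.
by move: le1; rewrite -inE pj eqxx; case: in1 => [[-> _]|[-> _]]; [case: (h r j)|case: (V r.+1 j)].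
Qed.

Lemma follows_ex (r : 'I_k) (j : 'I_n) : node D r j -> V r j || h r j.+1 ->
  exists y, follows (inl (r, j)) y.
Proof.
move=> nj /orP[Vr|hr].
  case: (pickP [pred a : 'I_k | (a < r) && node D a j]) => [a0 Pa0|no].
    case: (@arg_maxnP _ a0 _ val Pa0) => a /= /andP[lta na] maxa.
    exists (inl (a, j)); rewrite /follows /= nj na !eqxx lta Vr ltnn andbF orbF !andbT /=.
    apply/forallP=> b; apply/implyP=> /andP[ltab ltbr]; apply/negP=> nb.
    by have := maxa b; rewrite ltbr nb leqNgt ltab => /(_ isT).
  exists (inr j); rewrite /follows /= nj Vr eqxx andbT.
  apply/forallP=> a; apply/implyP=> ltar; apply/negP=> na.
  by have := no a; rewrite /= ltar na.
case: (pickP [pred b : 'I_n | (j < b) && node D r b]) => [b0 Pb0|no].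
  case: (@arg_minnP _ b0 _ val Pb0) => b /= /andP[ltb nb] minb.
  have nob : [forall b' : 'I_n, (j < b' < b) ==> ~~ node D r b'].
    apply/forallP=> a; apply/implyP=> /andP[ltab ltbr]; apply/negP=> na.
    by have := minb a; rewrite ltab na leqNgt ltbr => /(_ isT).
  have hb : h r b.
    by rewrite -(@horizontal_skip r j.+1) // 1?ltnW // => c; apply/implyP/(forallP nob).
  have npb : D r b != Pivot.
    apply/eqP=> pb; have [inE] := node_step nb; rewrite -inE pb hb eqxx.
    by case: (V _ _).
  exists (inl (r, b)); rewrite /follows /= nj nb npb nob ltb eqxx ltnn andbF /=.
  by rewrite -val_eqE gtn_eqF.
have := hn r; rewrite -(@horizontal_skip r j.+1) ?hr // => b ltb.
apply/negP=> nb; have := no b; rewrite /= nb andbT.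
by case/andP: ltb => ->.
Qed.

Lemma follows_path (r : 'I_k) (j : 'I_n) : node D r j -> V r j || h r j.+1 ->
  exists p (c : 'I_n), path follows (inl (r, j)) p /\ last (inl (r, j)) p = inr c.
Proof.
have [m] := ubnP (vrank (inl (r, j))); elim: m r j => // m IH r j.
rewrite ltnS => lem nj out; have [y fy] := follows_ex nj out.
have lty : vrank y < vrank (inl (r, j)) by apply: (@edge_vrank _ _ D); case/andP: fy.
case: y fy lty => [[r' j']|c] fy lty; last by exists [:: inr c], c; rewrite /= fy.
have [nj' in1] := follows_node fy; have [inE le1] := node_step nj'.
have [|//||p [c [pp lp]]] := IH r' j'; first exact: leq_trans lty lem.
  move: inE; case: in1 => [[-> _]|[-> _]]; [case: (h r' j')|case: (V r'.+1 j')];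
    by case: (V r' j'); case: (h r' j'.+1).
by exists (inl (r', j') :: p), c; rewrite /= fy.
Qed.

Lemma follows_disjoint x x' p p' :
  path follows x p -> path follows x' p' ->
  (forall y, ~ follows y x) -> (forall y, ~ follows y x') -> x != x' ->
  [disjoint x :: p & x' :: p'].
Proof.
move=> /(pathP x) pp /(pathP x) pp' nox nox' nexx'; apply/pred0P=> v /=.
apply/negP=> /andP[/(nthP x)[m ltm mE] /(nthP x)[l ltl lE]].
have {v mE lE} : nth x (x :: p) m = nth x (x' :: p') l by rewrite mE.
elim: m ltm l ltl => [|m IH] ltm [|l] ltl /=.
- exact/eqP.
- by move=> eqx; have /= := pp' l ltl; rewrite -eqx => /nox.
- by move=> eqx; have /= := pp m ltm; rewrite eqx => /nox'.
move=> eqx; apply: (IH (ltnW ltm) l (ltnW ltl)).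
by apply: (@follows_inj _ _ (nth x p m)); [exact: pp | rewrite eqx; exact: pp'].
Qed.

Lemma step_sum (r : 'I_k) (j : 'I_n) :
  (V r.+1 j + h r j + (D r j == Pivot) = V r j + h r j.+1)%N.
Proof.
have := hstep r j; rewrite stepE; case: ifP => [_ /andP[/eqP]//|].
rewrite !inE => /negbT; rewrite negb_or => /andP[/negbTE-> _].
by case/andP=> /eqP-> /eqP->; rewrite addn0.
Qed.

Lemma row_count (r : 'I_k) :
  (\sum_(j < n) V r j = (\sum_(j < n) V r.+1 j).+1)%N.
Proof.
have shift : (\sum_(j < n) h r j = \sum_(j < n) h r j.+1)%N.
  have := @big_ord_recr _ 0 addn n (fun j : 'I_n.+1 => h r j : nat).
  by rewrite big_ord_recl /= h0 hn addn0 add0n => <-; apply: eq_bigr.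
have pivots : (\sum_(j < n) (D r j == Pivot) = 1)%N.
  rewrite (bigD1 (u r)) //= (iffRL (pivD r (u r)) erefl) eqxx big1 // => j nej.
  by case: eqP => // /pivD ej; rewrite ej eqxx in nej.
apply: (@addIn (\sum_(j < n) h r j)); rewrite {1}shift -big_split /=.
rewrite (eq_bigr _ (fun j _ => esym (step_sum r j))) !big_split /= pivots.
by rewrite addn1 addSn.
Qed.

Lemma level_count r : r <= k -> (\sum_(j < n) V (k - r) j = r)%N.
Proof.
elim: r => [|r IH] ltr; first by rewrite subn0 big1 // => j _; rewrite Vk.
have lt : k - r.+1 < k by lia.
have /= -> := row_count (Ordinal lt).
by rewrite (_ : (k - r.+1).+1 = k - r) ?IH //; lia.
Qed.

Lemma flow_admissible : #|[set j : 'I_n | V 0 j]%SET| = k /\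
  exists (s : 'I_k -> 'I_k * 'I_n) (P : 'I_k -> seq (vertex n k))
         (t : 'I_k -> 'I_n),
    admissible D s P t /\ [set j : 'I_n | V 0 j]%SET = [set t a | a in 'I_k]%SET.
Proof.
have cardJ : #|[set j : 'I_n | V 0 j]%SET| = k.
  rewrite -[RHS](level_count (leqnn k)) subnn -sum1_card big_mkcond /=.
  by apply: eq_bigr => j _; rewrite inE; case: (V 0 j).
split=> //; pose s a := (a, u a).
have ps a : D a (u a) = Pivot by apply: (iffRL (pivD a _)).
have ns a : node D a (u a) by rewrite /node ps !inE eqxx.
have paths a : exists pc : seq (vertex n k) * 'I_n,
    path follows (inl (s a)) pc.1 /\ last (inl (s a)) pc.1 = inr pc.2.
  have [|p [c pc]] := @follows_path a (u a) (ns a); last by exists (p, c).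
  have [inE _] := node_step (ns a); move: inE; rewrite ps eqxx.
  by case: (V a (u a)) (h a (u a).+1) => [] []; rewrite ?addn1.
have [pc pcP] := choice paths.
have disj a b : a != b ->
    [disjoint (inl (s a) : vertex n k) :: (pc a).1 & inl (s b) :: (pc b).1].
  move=> neab; have [[pa _] [pb _]] := (pcP a, pcP b).
  apply: follows_disjoint pa pb _ _ _ => [y|y|]; try exact: no_follows_pivot.
  by apply: contra neab => /eqP[->].
exists s, (fun a => (pc a).1), (fun a => (pc a).2).
have adm : admissible D s (fun a => (pc a).1) (fun a => (pc a).2).
  split=> // a; have [pa la] := pcP a; split=> //.
  by apply: sub_path pa => x y /andP[].
split=> //; apply/esym/eqP; rewrite eqEcard cardJ; apply/andP; split.
  apply/fintype.subsetP=> _ /imsetP[a _ ->]; rewrite inE.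
  have [pa la] := pcP a.
  have := la; case/lastP: ((pc a).1) pa => [//|p y].
  rewrite rcons_path last_rcons => /andP[_ fy] ey.
  by move: fy; rewrite ey => /follows_sink[].
rewrite card_imset ?card_ord // => a b eqt; apply/eqP/negPn/negP=> /disj.
move/disjointFr=> /(_ (inr (pc a).2)).
by rewrite -{1}(pcP a).2 mem_last eqt -(pcP b).2 mem_last => /(_ isT).
Qed.

End FlowToPaths.

Theorem sink_sets_flow n k (D : 'M[tile]_(k, n)) u (J : {set 'I_n}) :
  pivot_columns D u -> sink_sets D J <-> flow D J.
Proof.
move=> pivD; split.
  by case=> _ [s [P [t [admP ->]]]]; apply: (admissible_flow pivD admP).
case=> V [Vk rowV ->].
have [h hP] := choice rowV.
have [] := @flow_admissible n k D u pivD V h Vk; try by move=> r; case: (hP r).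
by move=> cardJ [s [P [t admP]]]; split=> //; exists s, P, t.
Qed.

(** * Labels of pipes *)

Lemma route_right T e : route T e = Some ToRight ->
  e = FromLeft /\ (T = Horizontal \/ T = Cross) \/
  e = FromTop /\ (T = Pivot \/ T = Elbow).
Proof. by case: T => //; case: e => //; auto. Qed.

Lemma route_bottom T e : route T e = Some ToBottom ->
  e = FromTop /\ (T = Vertical \/ T = Cross) \/ e = FromLeft /\ T = Elbow.
Proof. by case: T => //; case: e => //; auto. Qed.

Lemma route_inj T e e' x : route T e = Some x -> route T e' = Some x -> e = e'.
Proof. by case: T; case: e; case: e'; case: x. Qed.

Section Pipes.

Variables (n : nat) (E : 'M[tile]_n).

Definition leaves (p i j : 'I_n) (x : exit) : Prop :=
  exists2 e, enters E p i j e & route (E i j) e = Some x.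

Lemma enters_topP p i j : enters E p i j FromTop ->
  (i = 0 :> nat /\ j = p) \/
  exists i0 : 'I_n, i = i0.+1 :> nat /\ leaves p i0 j ToBottom.
Proof.
move eE: FromTop => e ent.
case: ent eE => {i j e} [i i0|//|i i' j e ent rt ei _]; first by left.
by right; exists i; split=> //; exists e.
Qed.

Lemma enters_leftP p i j : enters E p i j FromLeft ->
  exists j0 : 'I_n, j = j0.+1 :> nat /\ leaves p i j0 ToRight.
Proof.
move eE: FromLeft => e ent.
by case: ent eE => {i j e} [//|i j j' e ent rt ej _|//]; exists j; split=> //; exists e.
Qed.

Lemma leaves_rightP p i j : leaves p i j ToRight ->
  enters E p i j FromLeft /\ (E i j = Horizontal \/ E i j = Cross) \/
  enters E p i j FromTop /\ (E i j = Pivot \/ E i j = Elbow).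
Proof. by case=> e ent /route_right[[ee tE]|[ee tE]]; rewrite ee in ent; auto. Qed.

Lemma leaves_bottomP p i j : leaves p i j ToBottom ->
  enters E p i j FromTop /\ (E i j = Vertical \/ E i j = Cross) \/
  enters E p i j FromLeft /\ E i j = Elbow.
Proof. by case=> e ent /route_bottom[[ee tE]|[ee tE]]; rewrite ee in ent; auto. Qed.

Lemma leaves_enters_top (p i i' j : 'I_n) : leaves p i j ToBottom -> i' = i.+1 :> nat ->
  enters E p i' j FromTop.
Proof. by case=> e ent rt ei; apply: enters_down ent rt ei. Qed.

Lemma leaves_enters_left (p i j j' : 'I_n) : leaves p i j ToRight -> j' = j.+1 :> nat ->
  enters E p i j' FromLeft.
Proof. by case=> e ent rt ej; apply: enters_right ent rt ej. Qed.

Lemma enters_unique p q i j e : enters E p i j e -> enters E q i j e -> p = q.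
Proof.
move=> entp; elim: entp q => {i j e} [i i0|i j j' e _ IH rt ej|i i' j e _ IH rt ei] q.
- by case/enters_topP=> [[]|[i1 []]] //; rewrite i0.
- case/enters_leftP=> j1 []; rewrite ej => -[/val_inj <-] [e1 ent1 rt1].
  by apply: IH; rewrite (route_inj rt rt1).
case/enters_topP=> [[]|[i1 []]]; first by rewrite ei.
rewrite ei => -[/val_inj <-] [e1 ent1 rt1].
by apply: IH; rewrite (route_inj rt rt1).
Qed.

Lemma enters_ge p i j e : enters E p i j e -> p <= i + j.
Proof. by elim=> [?|? ? ? ? _ ? _|? ? ? ? _ ? _]; lia. Qed.

Lemma enters_diag p i j e i' j' e' : enters E p i j e -> enters E p i' j' e' ->
  i + j = i' + j' -> [/\ i = i', j = j' & e = e'].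
Proof.
move=> ent; elim: ent i' j' e'
  => {i j e} [i i0|i j j1 e ent IH rt ej|i i1 j e ent IH rt ei] i' j' [].
- case/enters_topP=> [[i'0 ->]|[i2 [ei2 [e2 /enters_ge ge2 _]]]]; last by lia.
  by split=> //; apply: val_inj; rewrite /= i0.
- by case/enters_leftP=> j2 [ej2 [e2 /enters_ge ge2 _]]; lia.
- case/enters_topP=> [[i'0 ej']|[i2 [ei2 [e2 ent2 rt2]]]].
    by move/enters_ge: ent; rewrite ej'; lia.
  move=> sumE; have [|ei3 ej3 ee3] := IH _ _ _ ent2; first by lia.
  by rewrite -ei3 -ej3 -ee3 rt in rt2.
- case/enters_leftP=> j2 [ej2 [e2 ent2 rt2]] sumE.
  have [|ei3 ej3 ee3] := IH _ _ _ ent2; first by lia.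
  by split=> //; apply: val_inj; rewrite /= ej ej2 ej3.
- case/enters_topP=> [[i'0 ej']|[i2 [ei2 [e2 ent2 rt2]]]].
    by move/enters_ge: ent; rewrite ej'; lia.
  move=> sumE; have [|ei3 ej3 ee3] := IH _ _ _ ent2; first by lia.
  by split=> //; apply: val_inj; rewrite /= ei ei2 ei3.
case/enters_leftP=> j2 [ej2 [e2 ent2 rt2]] sumE.
have [|ei3 ej3 ee3] := IH _ _ _ ent2; first by lia.
by rewrite -ei3 -ej3 -ee3 rt in rt2.
Qed.

Lemma enters_le p i j e i' j' e' : enters E p i j e -> enters E p i' j' e' ->
  i' + j' <= i + j -> i' <= i /\ j' <= j.
Proof.
move=> ent; elim: ent i' j' e'
  => {i j e} [i i0|i j j1 e ent IH rt ej|i i1 j e ent IH rt ei] i' j' e' ent'.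
- have := enters_ge ent' => ge' le'.
  by have [|-> ->] := enters_diag (enters_start E p i0) ent'; first by lia.
- rewrite leq_eqVlt => /orP[/eqP sumE|lt'].
    by have [|-> ->] := enters_diag (enters_right ent rt ej) ent'.
  by have [|? ?] := IH _ _ _ ent'; lia.
rewrite leq_eqVlt => /orP[/eqP sumE|lt'].
  by have [|-> ->] := enters_diag (enters_down ent rt ei) ent'.
by have [|? ?] := IH _ _ _ ent'; lia.
Qed.

Definition crossed_before (p q : 'I_n) (c m : nat) : Prop :=
  exists i j : 'I_n, cross_at E p q i j /\ (i < c \/ i = c :> nat /\ j < m).

Lemma crossed_before_le p q c m c' m' :
  crossed_before p q c m -> c < c' \/ c = c' /\ m <= m' ->
  crossed_before p q c' m'.
Proof. by move=> [i [j [cr lt]]] le; exists i, j; split=> //; lia. Qed.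

Definition tops_sorted (i : 'I_n) : Prop := forall p q y z : 'I_n,
  enters E p i y FromTop -> enters E q i z FromTop -> y < z -> q < p ->
  crossed_before p q i 0.

Lemma left_top_sorted (i : 'I_n) : tops_sorted i -> forall l t j z : 'I_n,
  enters E l i j FromLeft -> enters E t i z FromTop -> j <= z -> t < l ->
  crossed_before l t i j.
Proof.
move=> srt l t j z; have [m] := ubnP j; elim: m j => // m IH j.
rewrite ltnS => lem /enters_leftP[j0 [ej /leaves_rightP[[ent _]|[ent _]]]] entt lez lt.
  apply: crossed_before_le (IH j0 _ ent entt _ lt) _; lia.
apply: crossed_before_le (srt _ _ _ _ ent entt _ lt) _; lia.
Qed.

Lemma bottom_left_sorted (i : 'I_n) : tops_sorted i -> forall p l y j : 'I_n,
  leaves p i y ToBottom -> enters E l i j FromLeft -> y < j -> l < p ->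
  crossed_before p l i j.
Proof.
move=> srt p l y j; have [m] := ubnP j; elim: m j => // m IH j.
rewrite ltnS => lem lvp /enters_leftP[j0 [ej lvl]] ltj ltl.
have [ltj0|] := ltnP y j0.
  case/leaves_rightP: lvl => -[entl _].
    by apply: crossed_before_le (IH j0 _ lvp entl ltj0 ltl) _; lia.
  case/leaves_bottomP: lvp => -[entp _].
    by apply: crossed_before_le (srt _ _ _ _ entp entl ltj0 ltl) _; lia.
  by apply: crossed_before_le (left_top_sorted srt entp entl _ ltl) _; lia.
rewrite leq_eqVlt => /orP[/eqP/val_inj ej0|]; last by lia.
rewrite ej0 in lvl ej *.
case/leaves_bottomP: lvp => -[entp tp]; case/leaves_rightP: lvl => -[entl tl].
- have tC : E i y = Cross by case: tp tl => -> [].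
  exists i, y; split; last by lia.
  by split=> //; [rewrite -val_eqE gtn_eqF | exists FromTop | exists FromLeft].
- by case: tp tl => -> [].
- by move: tl; rewrite tp => -[].
by apply: crossed_before_le (left_top_sorted srt entp entl (leqnn _) ltl) _; lia.
Qed.

Lemma tops_sorted_all i : tops_sorted i.
Proof.
have [m] := ubnP i; elim: m i => // m IH i; rewrite ltnS => lem p q y z entp entq lty ltq.
case/enters_topP: entp => [[i0 ey]|[i0 [ei lvp]]].
  by case/enters_topP: entq => [[_ ez]|[i1 [ei1 _]]]; [rewrite ey ez in lty | ]; lia.
case/enters_topP: entq => [[ei0 _]|[i1 [ei1 lvq]]]; first by lia.
have ei10 : i1 = i0 by apply: val_inj; move: ei1; rewrite ei => -[].
rewrite {}ei10 {i1 ei1} in lvq.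
have srt : tops_sorted i0 by apply: IH; lia.
case/leaves_bottomP: (lvq) => -[entq tq]; last first.
  by apply: crossed_before_le (bottom_left_sorted srt lvp entq lty ltq) _; lia.
case/leaves_bottomP: lvp => -[entp tp].
  by apply: crossed_before_le (srt _ _ _ _ entp entq lty ltq) _; lia.
by apply: crossed_before_le (left_top_sorted srt entp entq (ltnW lty) ltq) _; lia.
Qed.

Variables (w v : 'S_n).
Hypothesis fppE : fpp w v E.

(* A left pipe with the larger label would have crossed the top pipe before,
   so that meeting again is excluded by reducedness or by the touching
   condition. *)
Lemma left_lt_top (i j l t : 'I_n) : E i j = Cross \/ E i j = Elbow ->
  enters E l i j FromLeft -> enters E t i j FromTop -> l < t.
Proof.
move=> tE entl entt; rewrite ltnNge leq_eqVlt; apply/norP; split.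
  apply/eqP=> /val_inj et; rewrite et in entt.
  by have [] := enters_diag entl entt.
apply/negP=> ltt; have nelt : l != t by rewrite -val_eqE gtn_eqF.
have vl : visits E l i j by exists FromLeft.
have vt : visits E t i j by exists FromTop.
have [i' [j' [cr lt]]] := left_top_sorted (@tops_sorted_all i) entl entt (leqnn j) ltt.
case: tE => tE.
  have [ei ej] : i = i' /\ j = j' by apply: (fpp_reduced fppE) cr.
  by rewrite ei ej in lt; lia.
have tch : touch_at E l t i j by [].
apply: (fpp_touch fppE cr tch); have [_ [e' ent'] _ _] := cr.
have [le|gt] := leqP (i' + j') (i + j); first exact: enters_le entl ent' le.
by have [] := enters_le ent' entl (ltnW gt); lia.
Qed.

Variant tile_spec (i j : 'I_n) : tile -> Prop :=
| PivotSpec of j = w i : tile_spec i j Pivot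
| EmptySpec of (w^-1)%g j < i & j < w i : tile_spec i j Defs.Empty
| HorizontalSpec of (w^-1)%g j < i & w i < j : tile_spec i j Horizontal
| VerticalSpec of i < (w^-1)%g j & j < w i : tile_spec i j Vertical
| CrossSpec of i < (w^-1)%g j & w i < j : tile_spec i j Cross
| ElbowSpec of i < (w^-1)%g j & w i < j : tile_spec i j Elbow.

Lemma tileP i j : tile_spec i j (E i j).
Proof.
have rE := fpp_rothe fppE.
have [lti|gti|ei] := ltngtP i ((w^-1)%g j); last first.
- have -> : j = w i by rewrite (val_inj ei) permKV.
  by rewrite (rothe_pivot rE); constructor.
- have [ltj|gtj|ej] := ltngtP j (w i).
  + by rewrite (rothe_empty rE) //; constructor.
  + by rewrite (rothe_horizontal rE) //; constructor.
  by move: gti; rewrite (val_inj ej) permK ltnn.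
have [ltj|gtj|ej] := ltngtP j (w i).
- by rewrite (rothe_vertical rE) //; constructor.
- by case: (rothe_other rE lti gtj) => ->; constructor.
by move: lti; rewrite (val_inj ej) permK ltnn.
Qed.

Lemma enters_top_le p (i j : 'I_n) : enters E p i j FromTop -> i <= (w^-1)%g j.
Proof.
case/enters_topP=> [[-> //]|[i0 [-> /leaves_bottomP[[_]|[_]]]]].
  by case: (tileP i0 j) => [?|? ?|? ?|? ?|? ?|? ?] [].
by case: (tileP i0 j).
Qed.

Lemma enters_left_lt p (i j : 'I_n) : enters E p i j FromLeft -> w i < j.
Proof.
case/enters_leftP=> j0 [-> /leaves_rightP[[_]|[_]]]; rewrite ltnS.
  by case: (tileP i j0) => [?|? ?|? /ltnW ?|? ?|? /ltnW ?|? ?] [].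
by case: (tileP i j0) => [->|? ?|? ?|? ?|? ?|? /ltnW ?] [].
Qed.

Lemma pipes_exist (i j : 'I_n) :
  (i <= (w^-1)%g j -> exists p, enters E p i j FromTop) /\
  (w i < j -> exists p, enters E p i j FromLeft).
Proof.
have [m] := ubnP i; elim: m i j => // m IHi i j; rewrite ltnS => lei.
have top j' : i <= (w^-1)%g j' -> exists p, enters E p i j' FromTop.
  move=> lej; have [i0|gti0] := posnP i; first by exists j'; constructor.
  have lti' : i.-1 < n by have := ltn_ord i; lia.
  have ei' : i = (Ordinal lti').+1 :> nat by rewrite /= prednK.
  have lt' : Ordinal lti' < (w^-1)%g j' by rewrite /=; lia.
  have ltm : Ordinal lti' < m by rewrite /=; lia.
  have [/(_ (ltnW lt'))[t entt] l] := IHi (Ordinal lti') j' ltm.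
  case tE : _ / (tileP (Ordinal lti') j') => [ej||||ltw gtw|ltw gtw]; try by lia.
  - by move: lt'; rewrite ej permK ltnn.
  - by exists t; apply: enters_down entt _ ei'; rewrite tE.
  - by exists t; apply: enters_down entt _ ei'; rewrite tE.
  have [l' entl] := l gtw; exists l'.
  by apply: enters_down entl _ ei'; rewrite tE.
split; first exact: top.
have [m'] := ubnP j; elim: m' j => // m' IHj j; rewrite ltnS => lej ltj.
have ltj' : j.-1 < n by have := ltn_ord j; lia.
have ej' : j = (Ordinal ltj').+1 :> nat by rewrite /= prednK //; lia.
case tE : _ / (tileP i (Ordinal ltj')) => [ej|_ lt|lt gt|_ lt|lt gt|lt gt].
- have [|t entt] := top (Ordinal ltj'); first by rewrite ej permK.
  by exists t; apply: enters_right entt _ ej'; rewrite tE.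
- by move: lt => /=; lia.
- have [||t entt] := IHj (Ordinal ltj'); rewrite //=; first by lia.
  by exists t; apply: enters_right entt _ ej'; rewrite tE.
- by move: lt => /=; lia.
- have [||t entt] := IHj (Ordinal ltj'); rewrite //=; first by lia.
  by exists t; apply: enters_right entt _ ej'; rewrite tE.
have [|t entt] := top (Ordinal ltj'); first exact: ltnW.
by exists t; apply: enters_right entt _ ej'; rewrite tE.
Qed.

Lemma row_labels_mono (i j j' l l' : 'I_n) :
  enters E l i j FromLeft -> enters E l' i j' FromLeft -> j <= j' -> l <= l'.
Proof.
have [m] := ubnP j'; elim: m j' l' => // m IH j' l'; rewrite ltnS => lem entl entl'.
rewrite leq_eqVlt => /orP[/eqP/val_inj ej|ltj].
  by rewrite -ej in entl'; rewrite (enters_unique entl entl').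
case/enters_leftP: entl' => j0 [ej' /leaves_rightP[[ent _]|[ent tE]]].
  by apply: IH ent _ => //; lia.
have lej0 : j <= j0 by lia.
have ltj0 : w i < j0 by apply: leq_trans (enters_left_lt entl) lej0.
have [r entr] := (pipes_exist i j0).2 ltj0.
case: tE => tE; first by move: tE ltj0; case: tileP => // ->; rewrite ltnn.
apply: leq_trans (IH j0 r _ entl entr lej0) (ltnW (left_lt_top _ entr ent)); last by right.
by lia.
Qed.

End Pipes.

Section FlowsAndPipes.

Variables (n : nat) (E : 'M[tile]_n) (w v : 'S_n).
Hypothesis fppE : fpp w v E.
Variables (k d0 : nat) (V : nat -> nat -> bool).
Hypothesis le_kn : k <= n.
Hypothesis Vk : forall j, V k j = false.
Hypothesis rowV : forall r : 'I_n, d0 <= r < k -> row_flow (E r) (V r.+1) (V r).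

Lemma inverted_flow (d p q y z : 'I_n) : d0 <= d -> d <= k ->
  enters E p d y FromTop -> enters E q d z FromTop -> y < z -> q < p ->
  V d y -> V d z.
Proof.
have [m] := ubnP (k - d); elim: m d p q y z => // m IH d p q y z.
rewrite ltnS => lem led0 ledk entp entq lty ltq Vy.
have ltdk : d < k.
  by rewrite ltn_neqAle ledk andbT; apply/eqP=> ed; rewrite ed Vk in Vy.
have IHb p' q' y' z' : leaves E p' d y' ToBottom -> leaves E q' d z' ToBottom ->
    y' < z' -> q' < p' -> V d.+1 y' -> V d.+1 z'.
  move=> lvp lvq lty' ltq' Vy'.
  have ltd1 : d.+1 < k.
    by rewrite ltn_neqAle ltdk andbT; apply/eqP=> ed; rewrite ed Vk in Vy'.
  pose d' := Ordinal (leq_trans ltd1 le_kn).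
  have ed' : d' = d.+1 :> nat by [].
  apply: (IH d' p' q' y' z') => //; rewrite /=; try by lia.
    exact: leaves_enters_top lvp ed'.
  exact: leaves_enters_top lvq ed'.
have [|h [h0 hn hstep]] := rowV (r := d); first by rewrite led0.
have lez := enters_top_le fppE entq; have ley := enters_top_le fppE entp.
have no_y_right : leaves E p d y ToRight -> w d < z -> False.
  move=> lvp ltwz.
  have [l entl] := (pipes_exist fppE d z).2 ltwz.
  have tz : E d z = Cross \/ E d z = Elbow.
    by case: (tileP fppE d z) lez ltwz => [->|?|?|? ?|? ?|? ?]; auto; lia.
  have lty1 : y.+1 < n by have := ltn_ord z; lia.
  have entp1 : enters E p d (Ordinal lty1) FromLeft.
    exact: leaves_enters_left lvp _.
  have := row_labels_mono fppE entp1 entl lty.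
  by have := left_lt_top fppE tz entl entq; lia.
have ty : E d y = Vertical \/ E d y = Cross.
  case tE : _ / (tileP fppE d y) => [ey|||||_ gt]; auto; try by lia.
    by case: no_y_right; [exists FromTop; rewrite // tE | rewrite -ey].
  by case: no_y_right; [exists FromTop; rewrite // tE | apply: ltn_trans gt lty].
have lvp : leaves E p d y ToBottom by exists FromTop => //; case: ty => ->.
have Vy1 : V d.+1 y.
  have nny : ~~ is_node (E d y) by case: ty => ->.
  by have [<- _] := step_nonnode nny (hstep y).
have carried (j : 'I_n) : z < j -> enters E q d j FromLeft -> ~~ h j.
  have [m'] := ubnP (n - j); elim: m' j => // m' IHj j; rewrite ltnS => lej ltzj entq'.
  have nextj : leaves E q d j ToRight -> ~~ h j.+1.
    move=> lvq; have [ltj1|] := ltnP j.+1 n; last first.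
      by move=> gej; rewrite (_ : j.+1 = n) ?hn //; have := ltn_ord j; lia.
    apply: (IHj (Ordinal ltj1)) => /=; try by lia.
    exact: leaves_enters_left lvq _.
  have := hstep j; have := enters_left_lt fppE entq'.
  case tE : _ / (tileP fppE d j) => [->|? ?|? ?|? ?|? ?|? ?] ltw; try by lia.
  - by case/step_nonnode=> // _ <-; apply: nextj; exists FromLeft; rewrite // tE.
  - by case/step_nonnode=> // _ <-; apply: nextj; exists FromLeft; rewrite // tE.
  have lvq : leaves E q d j ToBottom by exists FromLeft; rewrite // tE.
  have -> : V d.+1 j by apply: IHb lvp lvq _ _ Vy1 => //; lia.
  by case: (h j) (V d j) (h j.+1) => [] [] [].
apply/negPn/negP=> /negbTE nVz.
have right_false : leaves E q d z ToRight -> h z.+1 -> False.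
  move=> lvq; have [ltz1|] := ltnP z.+1 n; last first.
    by move=> gez; rewrite (_ : z.+1 = n) ?hn //; have := ltn_ord z; lia.
  by apply/negP; apply: (carried (Ordinal ltz1)) => //; apply: leaves_enters_left lvq _.
have := hstep z; rewrite nVz.
case tE : _ / (tileP fppE d z) => [_||||_ _|_ ltz]; try by lia.
- case: (V d.+1 z) (h z) (h z.+1) right_false => [] [] [] // [] //.
  by exists FromTop; rewrite // tE.
- have lvq : leaves E q d z ToBottom by exists FromTop; rewrite // tE.
  by rewrite (IHb _ _ _ _ lvp lvq).
- have lvq : leaves E q d z ToBottom by exists FromTop; rewrite // tE.
  by rewrite (IHb _ _ _ _ lvp lvq).
have [l entl] := (pipes_exist fppE d z).2 ltz.
have lvl : leaves E l d z ToBottom by exists FromLeft; rewrite // tE.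
have ltl : l < q by apply: left_lt_top fppE _ _ _ _ _ entl entq; right.
rewrite (IHb _ _ _ _ lvp lvl) //; last exact: ltn_trans ltl ltq.
case: (h z) (h z.+1) right_false => [] [] // [] //.
by exists FromTop; rewrite // tE.
Qed.

Lemma cross_flow (c y z : 'I_n) : d0 <= c.+1 -> c < k -> E c y = Cross ->
  V c.+1 y -> y < z -> is_node (E c z) ->
  (forall l : 'I_n, y < l < z -> ~~ is_node (E c l)) -> V c.+1 z.
Proof.
move=> led0 ltck tC Vy lty nz noz.
have ltc1 : c.+1 < k.
  by rewrite ltn_neqAle ltck andbT; apply/eqP=> ec; rewrite ec Vk in Vy.
pose c' := Ordinal (leq_trans ltc1 le_kn).
have [ltcy ltwy] : c < (w^-1)%g y /\ w c < y.
  by move: tC; case: (tileP fppE c y).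
have [p entp] := (pipes_exist fppE c y).1 (ltnW ltcy).
have [q entq] := (pipes_exist fppE c y).2 ltwy.
have ltq : q < p by apply: left_lt_top fppE _ _ _ _ _ entq entp; left.
have along (j : 'I_n) : y < j -> j <= z -> enters E q c j FromLeft.
  have [m] := ubnP j; elim: m j => // m IH j; rewrite ltnS => lem ltyj lejz.
  have ltj1 : j.-1 < n by have := ltn_ord j; lia.
  have ej : j = (Ordinal ltj1).+1 :> nat by rewrite /= prednK //; lia.
  have [ey|ney] := eqVneq y (Ordinal ltj1).
    apply: leaves_enters_left ej; rewrite -ey; exists FromLeft => //.
    by rewrite tC.
  have lty1 : y < Ordinal ltj1 by move: ney; rewrite -val_eqE /=; lia.
  have entq1 := IH (Ordinal ltj1).
  apply: leaves_enters_left ej; exists FromLeft.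
    by apply: entq1 => //=; lia.
  have := noz (Ordinal ltj1); rewrite lty1 /= (_ : j.-1 < z); last by lia.
  move=> /(_ isT).
  by case: (tileP fppE c (Ordinal ltj1)) => //= *; move: ltwy lty1 => /=; lia.
have lvq : leaves E q c z ToBottom.
  exists FromLeft; first exact: along.
  move: nz; case: (tileP fppE c z) => // ez; move: lty; rewrite ez; lia.
apply: (@inverted_flow c' p q y z) => //=.
  apply: leaves_enters_top (_ : c' = c.+1 :> nat) => //.
  by exists FromTop; rewrite // tC.
exact: leaves_enters_top lvq _.
Qed.

End FlowsAndPipes.

Section Standardization.

Variables (n : nat) (E : 'M[tile]_n) (w v : 'S_n).
Hypothesis fppE : fpp w v E.

Lemma no_node_after_cross (r r' j0 j : 'I_n) : r' = r.+1 :> nat ->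
  w r' <= j0 -> E r j0 = Cross -> is_node (E r' j0) ->
  j0 <= j -> ~~ is_node (E r j).
Proof.
move=> er lew tC tE.
have [ltrj ltwj] : r < (w^-1)%g j0 /\ w r < j0.
  by move: tC; case: (tileP fppE r j0).
have [p entp] := (pipes_exist fppE r j0).2 ltwj.
have [q entq] := (pipes_exist fppE r j0).1 (ltnW ltrj).
have ltp : p < q by apply: left_lt_top fppE _ _ _ _ _ entp entq; left.
have lvp : leaves E p r j0 ToRight by exists FromLeft; rewrite // tC.
have lvq : leaves E q r' j0 ToRight.
  exists FromTop; last by move: tE; case: (E r' j0).
  by apply: leaves_enters_top er; exists FromTop; rewrite // tC.
suff inv : j0 < j -> exists a b, [/\ enters E a r j FromLeft,
    enters E b r' j FromLeft & a < b] /\ ~~ is_node (E r j).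
  by rewrite leq_eqVlt => /orP[/eqP/val_inj<-|/inv[a [b []]]//]; rewrite tC.
have [m] := ubnP j; elim: m j => // m IH j; rewrite ltnS => lem lt0j.
have ltj1 : j.-1 < n by have := ltn_ord j; lia.
pose j1 := Ordinal ltj1.
have ej : j = j1.+1 :> nat by rewrite /= prednK //; lia.
have step1 : exists a b, [/\ enters E a r j FromLeft, enters E b r' j FromLeft & a < b].
  have [ej0|ne0] := eqVneq j0 j1.
    rewrite ej0 in lvp lvq; exists p, q.
    by split=> //; [apply: leaves_enters_left lvp ej | apply: leaves_enters_left lvq ej].
  have lt01 : j0 < j1 by move: ne0; rewrite -val_eqE /=; lia.
  have [||a [b [[enta entb ltab]]]] := IH j1 => //; first by rewrite /=; lia.
  have lta := enters_left_lt fppE enta; have ltb := enters_left_lt fppE entb.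
  case tr : _ / (tileP fppE r j1) => [||ltw _||ltw _|] // _; try by lia.
  - exists a, b; split=> //; first by apply: leaves_enters_left ej; exists FromLeft; rewrite // tr.
    apply: leaves_enters_left ej; exists FromLeft => //.
    case: (tileP fppE r' j1) => [ew|*|*|*|*|*] //; try by lia.
    by move: ltb; rewrite ew ltnn.
  have [t entt] := (pipes_exist fppE r j1).1 (ltnW ltw).
  have ltat : a < t by apply: left_lt_top fppE _ _ _ _ _ enta entt; left.
  have entt' : enters E t r' j1 FromTop.
    by apply: leaves_enters_top er; exists FromTop; rewrite // tr.
  have enta' : enters E a r j FromLeft.
    by apply: leaves_enters_left ej; exists FromLeft; rewrite // tr.
  have let' := enters_top_le fppE entt'.
  case tr' : _ / (tileP fppE r' j1) => [ew|||||]; try by lia.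
  - by move: ltb; rewrite ew ltnn.
  - exists a, b; split=> //.
    by apply: leaves_enters_left ej; exists FromLeft; rewrite // tr'.
  exists a, t; split=> //.
  by apply: leaves_enters_left ej; exists FromTop; rewrite // tr'.
have [a [b [enta entb ltab]]] := step1; exists a, b; split=> //.
have lta := enters_left_lt fppE enta; have ltb := enters_left_lt fppE entb.
case tr : _ / (tileP fppE r j) => [ew|||||ltw _] //; first by move: lta; rewrite ew ltnn.
have enta' : enters E a r' j FromTop.
  by apply: leaves_enters_top er; exists FromLeft; rewrite // tr.
have le' := enters_top_le fppE enta'.
suff t' : E r' j = Cross \/ E r' j = Elbow.
  by have := left_lt_top fppE t' entb enta'; lia.
case: (tileP fppE r' j) => [ew|||||]; auto; try by lia.
by move: ltb; rewrite ew ltnn.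
Qed.

End Standardization.

(** * Two consecutive rows *)

Lemma stepN T s h t h' : ~~ is_node T -> step T s h t h' = (t == s) && (h' == h).
Proof. by case: T. Qed.

Section Runs.

Variables (n : nat) (W X : 'I_n -> tile) (S T : nat -> bool).

(* [W] is the lower row and [X] the upper one; [x] and [y] are their flows across
   the left edge of column [m]. *)
Definition run2 (m : nat) (x y : bool) : Prop :=
  exists M hW hX : nat -> bool,
    [/\ hW 0 = false, hX 0 = false, hW m = x, hX m = y &
        forall j : 'I_n, j < m ->
          step (W j) (S j) (hW j) (M j) (hW j.+1) /\
          step (X j) (M j) (hX j) (T j) (hX j.+1)].

Lemma run2_0 : run2 0 false false.
Proof. by exists xpred0, xpred0, xpred0. Qed.

Lemma run2_step (j : 'I_n) x y x' y' s : run2 j x y ->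
  step (W j) (S j) x s x' -> step (X j) s y (T j) y' -> run2 j.+1 x' y'.
Proof.
case=> M [hW [hX [W0 X0 Wj Xj st]]] stW stX.
exists (fun l => if l == j :> nat then s else M l),
       (fun l => if l == j.+1 then x' else hW l),
       (fun l => if l == j.+1 then y' else hX l).
split; rewrite ?eqxx // => l; rewrite ltnS leq_eqVlt => /orP[/eqP/val_inj->|ltl].
  by rewrite !eqxx (ltn_eqF (ltnSn j)) Wj Xj.
rewrite !(ltn_eqF ltl) (ltn_eqF (leqW ltl)) eqSS (ltn_eqF ltl).
exact: st.
Qed.

Lemma run2_flow : run2 n false false ->
  exists M, row_flow W S M /\ row_flow X M T.
Proof.
case=> M [hW [hX [W0 X0 Wn Xn st]]]; exists M.
by split; [exists hW | exists hX]; split=> // j; case: (st j).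
Qed.

End Runs.

Section TwoRows.

Variables (n : nat) (L U L' U' : 'I_n -> tile) (b : 'I_n) (js : nat).
Variables (S T : nat -> bool).
Hypotheses (le_bjs : b <= js) (le_jsn : js <= n).
Hypothesis left_nodes : forall j : 'I_n, j < b ->
  [/\ ~~ is_node (L j), ~~ is_node (U' j) & L' j = U j].
Hypothesis at_b : [/\ L b = Pivot, U' b = Pivot & ~~ is_node (L' b)].
Hypothesis at_b_elbow : b < js -> U b = Elbow.
Hypothesis middle : forall j : 'I_n, b < j < js ->
  [/\ L' j = L j, U' j = U j, is_node (L j) -> L j = Elbow /\ U j = Elbow
    & is_node (U j) -> U j = Elbow].
Hypothesis at_js : forall j : 'I_n, j = js :> nat -> b < js ->
  [/\ L j = Elbow, L' j = Elbow & U' j = Elbow].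
Hypothesis right_nodes : forall j : 'I_n, js < j ->
  ~~ is_node (L' j) /\ U' j = L j.
Hypothesis right_upper : forall j : 'I_n, js <= j -> ~~ is_node (U j).
Hypothesis crossed : forall y z : 'I_n, b < y < js -> ~~ is_node (L y) ->
  is_node (U y) -> S y -> y < z -> is_node (L z) ->
  (forall l : 'I_n, y < l < z -> ~~ is_node (L l)) -> S z.

Lemma flow_dead (W : 'I_n -> tile) (M N h : nat -> bool) lo : h n = false ->
  (forall j : 'I_n, step (W j) (M j) (h j) (N j) (h j.+1)) ->
  (forall j : 'I_n, lo <= j -> ~~ is_node (W j)) ->
  forall m, lo <= m -> m <= n -> h m = false.
Proof.
move=> hn st nn m lem lemn; have [q] := ubnP (n - m); elim: q m lem lemn => // q IH m lem.
rewrite leq_eqVlt => /orP[/eqP->//|ltmn] ltq.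
have [_ <-] := step_nonnode (nn (Ordinal ltmn) lem) (st _).
by apply: IH => //=; lia.
Qed.

Section Forward.

Variables (M hL hU : nat -> bool).
Hypotheses (L0 : hL 0 = false) (U0 : hU 0 = false).
Hypotheses (Ln : hL n = false) (Un : hU n = false).
Hypothesis stL : forall j : 'I_n, step (L j) (S j) (hL j) (M j) (hL j.+1).
Hypothesis stU : forall j : 'I_n, step (U j) (M j) (hU j) (T j) (hU j.+1).

Let run m x y := run2 L' U' S T m x y.

Lemma upper_dead m : js <= m -> m <= n -> hU m = false.
Proof. exact: flow_dead Un stU right_upper m. Qed.

Lemma crossed_dead (y : 'I_n) : b < y < js -> ~~ is_node (L y) ->
  is_node (U y) -> S y -> hL y.+1 = false.
Proof.
move=> by_ nL nU Sy; apply/negbTE/negP=> hy.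
suff inv m : y < m -> m <= n -> hL m /\ forall l : 'I_n, y < l < m -> ~~ is_node (L l).
  by have [] := inv n (ltn_ord y) (leqnn n); rewrite Ln.
elim: m => // m IH; rewrite ltnS leq_eqVlt => /orP[/eqP<-|ltym] ltmn.
  by split=> // l; lia.
have [hm nn] := IH ltym (ltnW ltmn).
have := stL (Ordinal ltmn); have [nm|nm] := boolP (is_node (L (Ordinal ltmn))).
  have -> : S (Ordinal ltmn) by apply: (crossed by_).
  by rewrite /= hm; case: (L _) nm => //=; case: (M m) (hL m.+1) => [] [].
case/(step_nonnode nm) => _ /= ->; split=> // l /andP[lt1]; rewrite ltnS leq_eqVlt.
case/orP=> [/eqP el|lt2]; last by apply: nn; rewrite lt1.
by rewrite (_ : l = Ordinal ltmn) //; apply: val_inj.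
Qed.

Lemma forward_left m : m <= b -> hL m = false /\ run m (hU m) false.
Proof.
elim: m => [|m IH] ltm; first by rewrite L0 U0; split=> //; apply: run2_0.
have ltmn : m < n by apply: ltn_trans ltm (ltn_ord b).
have [hLm runm] := IH (ltnW ltm); pose j := Ordinal ltmn.
have [nL nU' eL'] := left_nodes (j := j) ltm.
have [Mj ->] := step_nonnode nL (stL j); split=> //.
apply: (run2_step (j := j) (s := T j)) runm _ _; last by rewrite stepN // !eqxx.
by rewrite eL' -Mj; apply: stU.
Qed.

(* In the second alternative, the lower row of D carries the flow that the upper
   row of st_i(D) carries. *)
Lemma forward_middle m : b < m -> m <= js ->
  run m (hL m) (hU m) \/ [/\ hL m, ~~ hU m & run m false true].
Proof.
elim: m => // m IH; rewrite ltnS leq_eqVlt => /orP[/eqP<-|ltbm] ltmjs.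
  have [hLb runb] := forward_left (leqnn b); have [Lb U'b nL'] := at_b.
  have := stL b; have := stU b; rewrite at_b_elbow // Lb hLb.
  have next y' : step Pivot (S b) false (T b) y' -> run b.+1 (hU b) y'.
    move=> st; apply: (run2_step (s := S b)) runb _ _; first by rewrite stepN ?eqxx.
    by rewrite U'b.
  move: next; case: (S b) (M b) (hL b.+1) (T b) (hU b) (hU b.+1)
    => [] [] [] [] [] [] //= next _ _; try (by left; apply: next);
    by right; split=> //; apply: next.
have ltmn : m < n by apply: leq_trans ltmjs le_jsn.
pose j := Ordinal ltmn; have bj : b < j < js by rewrite ltbm.
have [eL eU nL nU] := middle bj.
case: (IH ltbm (ltnW ltmjs)) => [runm|[hLm hUm runm]].
  by left; apply: (run2_step (j := j) (s := M j)) runm _ _; rewrite ?eL ?eU.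
have next s x' y' : step (L j) (S j) false s x' -> step (U j) s true (T j) y' ->
    run m.+1 x' y'.
  by rewrite -eL -eU; apply: (run2_step (j := j)) runm.
have := stU j; have := stL j; rewrite /= hLm (negbTE hUm).
have [nodeL|nodeL] := boolP (is_node (L j)).
  have [LE UE] := nL nodeL; rewrite LE UE in next *; move: next => /=.
  case: (S m) (M m) (hL m.+1) (T m) (hU m.+1) => [] [] [] [] [] //= next _ _;
    try (by left; apply: (next false)); by right; split=> //; apply: (next false).
have [nodeU|nodeU] := boolP (is_node (U j)).
  have UE := nU nodeU; rewrite UE in next *; move: next => /=; rewrite !stepN // => next.
  case/andP=> /eqP eM /eqP hLm'; rewrite eM.
  have Sm : S m = false.
    by apply: contraTF hLm' => Sm; rewrite (@crossed_dead j).
  rewrite Sm in next *; move: next; rewrite hLm'.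
  case: (T m) (hU m.+1) => [] [] //= next _.
  by right; split=> //; apply: (next false); rewrite ?stepN.
rewrite !stepN // => /andP[/eqP eM /eqP->] /andP[/eqP eT /eqP->].
by right; split=> //; apply: (next (S m)); rewrite ?stepN //= ?eT ?eM ?eqxx.
Qed.

Lemma forward_js (j : 'I_n) : j = js :> nat -> run j.+1 false (hL j.+1).
Proof.
move=> ej; have nU : ~~ is_node (U j) by apply: right_upper; rewrite ej.
have hUj : hU j = false by apply: upper_dead; rewrite ?ej // -ej ltnW.
have := stL j; have [eT _] := step_nonnode nU (stU j).
have [ltb|] := ltnP b js; last first.
  move=> lejs; have ejb : j = b by apply: val_inj; move: lejs; rewrite -ej /=; lia.
  subst j; have [hLb runb] := forward_left (leqnn b); have [Lb U'b nL'] := at_b.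
  rewrite Lb hLb -eT => st; rewrite hUj in runb.
  apply: (run2_step (s := S b)) runb _ _; first by rewrite stepN ?eqxx.
  by rewrite U'b.
have [Lj L'j U'j] := at_js ej ltb.
have := @forward_middle j; rewrite ej ltb leqnn -ej => /(_ isT isT).
rewrite Lj hUj; case=> [runj|[hLj _ runj]].
  have next s y' : step Elbow (S j) (hL j) s false ->
      step Elbow s false (T j) y' -> run j.+1 false y'.
    by rewrite -{1}L'j -U'j; apply: run2_step.
  move: next; rewrite eT; case: (S j) (hL j) (M j) (hL j.+1) => [] [] [] [] //= next _;
    solve [by apply: (next true) | by apply: (next false)].
have next s y' : step Elbow (S j) false s false ->
    step Elbow s true (T j) y' -> run j.+1 false y'.
  by rewrite -{1}L'j -U'j; apply: run2_step runj.
move: next; rewrite eT hLj; case: (S j) (M j) (hL j.+1) => [] [] [] //= next _;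
  by apply: (next false).
Qed.

Lemma forward_right m : js < m -> m <= n -> run m false (hL m).
Proof.
elim: m => // m IH; rewrite ltnS leq_eqVlt => /orP[/eqP ejs|ltm] ltmn.
  by apply: (@forward_js (Ordinal ltmn)).
pose j := Ordinal ltmn; have [nL' eU'] := right_nodes (j := j) ltm.
have [eT _] := step_nonnode (right_upper (j := j) (ltnW ltm)) (stU j).
apply: (run2_step (j := j) (s := S j)) (IH ltm (ltnW ltmn)) _ _.
  by rewrite stepN ?eqxx.
by rewrite eU' eT; apply: stL.
Qed.

Lemma forward_run : run n false false.
Proof.
have [ltjs|] := ltnP js n; first by have := forward_right ltjs (leqnn n); rewrite Ln.
move=> gejs; have := @forward_middle n (ltn_ord b) gejs.
by rewrite Ln Un => -[|[]].
Qed.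

End Forward.

Section Backward.

Variables (M hL hU : nat -> bool).
Hypotheses (L0 : hL 0 = false) (U0 : hU 0 = false).
Hypotheses (Ln : hL n = false) (Un : hU n = false).
Hypothesis stL : forall j : 'I_n, step (L' j) (S j) (hL j) (M j) (hL j.+1).
Hypothesis stU : forall j : 'I_n, step (U' j) (M j) (hU j) (T j) (hU j.+1).

Let run m x y := run2 L U S T m x y.

Lemma lower_dead m : js < m -> m <= n -> hL m = false.
Proof. by apply: flow_dead Ln stL _ m => j /right_nodes[]. Qed.

Lemma backward_left m : m <= b -> hU m = false /\ run m false (hL m).
Proof.
elim: m => [|m IH] ltm; first by rewrite L0 U0; split=> //; apply: run2_0.
have ltmn : m < n by apply: ltn_trans ltm (ltn_ord b).
have [hUm runm] := IH (ltnW ltm); pose j := Ordinal ltmn.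
have [nL nU' eL'] := left_nodes (j := j) ltm.
have [Tj ->] := step_nonnode nU' (stU j); split=> //.
apply: (run2_step (j := j) (s := S j)) runm _ _; first by rewrite stepN // !eqxx.
by rewrite -eL' Tj; apply: stL.
Qed.

Definition next_filled m : Prop := forall z : 'I_n, m <= z -> is_node (L z) ->
  (forall l : 'I_n, m <= l < z -> ~~ is_node (L l)) -> S z.

(* [run m true false] lets D bring its flow to column j^* in the lower row; this
   can only fail if the next node of that row is already fed from below. *)
Lemma backward_middle m : b < m -> m <= js -> run m (hL m) (hU m) /\
  (~~ hL m -> hU m -> run m true false \/ next_filled m).
Proof.
elim: m => // m IH; rewrite ltnS leq_eqVlt => /orP[/eqP<-|ltbm] ltmjs.
  have [hUb runb] := backward_left (leqnn b); have [Lb U'b nL'] := at_b.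
  have [MS ->] := step_nonnode nL' (stL b); have := stU b; rewrite U'b MS hUb.
  have next s x' y' : step Pivot (S b) false s x' ->
      step Elbow s (hL b) (T b) y' -> run b.+1 x' y'.
    by rewrite -Lb -at_b_elbow //; apply: run2_step.
  move: next; case: (S b) (hL b) (T b) (hU b.+1) => [] [] [] [] //= next _.
  - by split=> //; apply: (next false).
  - by split=> //; apply: (next false).
  - by split=> //; apply: (next true).
  by split=> [|_ _]; [apply: (next true) | left; apply: (next false)].
have ltmn : m < n by apply: leq_trans ltmjs le_jsn.
pose j := Ordinal ltmn; have bj : b < j < js by rewrite ltbm.
have [eL eU nL nU] := middle bj.
have [runm alt] := IH ltbm (ltnW ltmjs).
have := stU j; have := stL j; rewrite eL eU => sL sU.
split; first exact: (run2_step (j := j)) runm sL sU.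
move: sL sU.
have filledS : ~~ is_node (L j) -> next_filled m -> next_filled m.+1.
  move=> nLj fil z lemz nz noz; apply: fil (ltnW lemz) nz _ => l /andP[].
  rewrite leq_eqVlt => /orP[/eqP el _|lt1 lt2]; last by apply: noz; rewrite lt1.
  by rewrite (_ : l = j) //; apply: val_inj.
have [nodeL|nodeL] := boolP (is_node (L j)).
  have [LE UE] := nL nodeL; rewrite LE UE /=.
  have next x y s x' y' : run m x y -> step Elbow (S j) x s x' ->
      step Elbow s y (T j) y' -> run m.+1 x' y'.
    by rewrite -{1}LE -UE; apply: (run2_step (j := j)).
  have fil : next_filled m -> S j.
    by apply=> // l; rewrite /=; lia.
  move: runm alt fil next => /=.
  case: (hL m) (hU m) (S m) (M m) (hL m.+1) (T m) (hU m.+1)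
    => [] [] [] [] [] [] [] //= runm alt fil next _ _ _ _.
  - by left; apply: next runm _ _ => //; exact: (erefl : step Elbow false true false true).
  - by left; case: (alt isT isT) => [r|/fil//]; apply: (next _ _ false) r _ _.
  - by left; apply: (next _ _ false) runm _ _.
have [nodeU|nodeU] := boolP (is_node (U j)).
  rewrite (nU nodeU) /= stepN // => /andP[/eqP eM /eqP->]; rewrite eM.
  have fil : S m -> next_filled m.+1.
    by move=> Sm z; apply: (@crossed j).
  have next : run m true false -> S m = false -> T m = false -> run m.+1 true false.
    move=> r Sm Tm; apply: (run2_step (j := j) (s := false)) r _ _.
      by rewrite stepN //= Sm.
    by rewrite (nU nodeU) /= Tm.
  case Sm: (S m) fil next alt => fil next alt; first by move=> _ _ _; right; apply: fil.
  case: (hU m) (T m) (hU m.+1) next alt => [] [] [] //= next alt _ nh _.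
  by case: (alt nh isT) => [r|fl]; [left; apply: next | right; apply: filledS].
rewrite !stepN // => /andP[/eqP eM /eqP->] /andP[/eqP eT /eqP->] nh hm.
case: (alt nh hm) => [r|fl]; [left | right; exact: filledS].
by apply: (run2_step (j := j) (s := S j)) r _ _; rewrite stepN ?eqxx //= eT eM eqxx.
Qed.

Lemma backward_js (j : 'I_n) : j = js :> nat -> run j.+1 (hU j.+1) false.
Proof.
move=> ej; have nU : ~~ is_node (U j) by apply: right_upper; rewrite ej.
have hLj : hL j.+1 = false by apply: lower_dead; rewrite // -ej.
have [ltb|] := ltnP b js; last first.
  move=> lejs; have ejb : j = b by apply: val_inj; move: lejs; rewrite -ej /=; lia.
  subst j; have [hUb runb] := backward_left (leqnn b); have [Lb U'b nL'] := at_b.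
  have [MS hLb] := step_nonnode nL' (stL b); rewrite -hLb hLj in runb.
  have := stU b; rewrite U'b MS hUb => st.
  apply: (run2_step (s := T b)) runb _ _; first by rewrite Lb.
  by rewrite stepN ?eqxx.
have [Lj L'j U'j] := at_js ej ltb.
have := @backward_middle j; rewrite ej ltb leqnn -ej => /(_ isT isT)[runj alt].
have next x x' : run j x false -> step Elbow (S j) x (T j) x' -> run j.+1 x' false.
  rewrite -{1}Lj => r st; apply: (run2_step (s := T j)) r st _.
  by rewrite stepN ?eqxx.
have fil : next_filled j -> S j.
  by apply=> //; [rewrite Lj | move=> l; lia].
have := stU j; have := stL j; rewrite L'j U'j hLj.
move: runj alt fil next.
case: (hL j) (hU j) (S j) (M j) (T j) (hU j.+1)
  => [] [] [] [] [] [] //= runj alt fil next _ _; try (by apply: next runj _).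
all: by case: (alt isT isT) => [r|/fil//]; apply: next r _.
Qed.

Lemma backward_right m : js < m -> m <= n -> run m (hU m) false.
Proof.
elim: m => // m IH; rewrite ltnS leq_eqVlt => /orP[/eqP ejs|ltm] ltmn.
  by apply: (@backward_js (Ordinal ltmn)).
pose j := Ordinal ltmn; have [nL' eU'] := right_nodes (j := j) ltm.
have nU := right_upper (j := j) (ltnW ltm).
have [eM _] := step_nonnode nL' (stL j).
apply: (run2_step (j := j) (s := T j)) (IH ltm (ltnW ltmn)) _ _.
  by rewrite -eU' -eM; apply: stU.
by rewrite stepN ?eqxx.
Qed.

Lemma backward_run : run n false false.
Proof.
have [ltjs|] := ltnP js n; first by have := backward_right ltjs (leqnn n); rewrite Un.
move=> gejs; have := @backward_middle n (ltn_ord b) gejs.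
by rewrite Ln Un => -[].
Qed.

End Backward.

Lemma two_rows :
  (exists M, row_flow L S M /\ row_flow U M T) <->
  (exists M, row_flow L' S M /\ row_flow U' M T).
Proof.
split=> -[M [[hL [L0 Ln stL]] [hU [U0 Un stU]]]]; apply: run2_flow.
  exact: (@forward_run M hL hU).
exact: (@backward_run M hL hU).
Qed.

End TwoRows.

(** * Standardization *)

Lemma row_flow_ext n (w w' : 'I_n -> tile) S T : w =1 w' ->
  row_flow w S T -> row_flow w' S T.
Proof. by move=> eqw [h [h0 hn st]]; exists h; split=> // j; rewrite -eqw. Qed.

Lemma flow_replace n k (D D' : 'M[tile]_(k, n)) (i i' : 'I_k) (J : {set 'I_n}) :
  i' = i.+1 :> nat ->
  (forall r j, r != i -> r != i' -> D' r j = D r j) ->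
  (forall V : nat -> nat -> bool, (forall j, V k j = false) ->
     (forall r : 'I_k, i' < r -> row_flow (D r) (V r.+1) (V r)) ->
     (exists M, row_flow (D i') (V i'.+1) M /\ row_flow (D i) M (V i)) ->
     exists M, row_flow (D' i') (V i'.+1) M /\ row_flow (D' i) M (V i)) ->
  flow D J -> flow D' J.
Proof.
move=> ei eD two [V [Vk rowV ->]].
have [|M [rowL rowU]] := two V Vk (fun r _ => rowV r).
  by exists (V i'); split; [exact: rowV | rewrite ei; exact: rowV].
exists (fun l => if l == i' :> nat then M else V l); split.
- by move=> j; rewrite gtn_eqF.
- move=> r; have [->|nri'] := eqVneq r i'; first by rewrite eqxx gtn_eqF.
  have [->|nri] := eqVneq r i; first by rewrite -ei eqxx ltn_eqF // ei.
  rewrite -!val_eqE /= in nri nri' *; rewrite (negbTE nri').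
  have /negbTE-> : r.+1 != i' by rewrite ei eqSS.
  by apply: row_flow_ext (rowV r) => j; rewrite eD.
by apply/setP=> j; rewrite !inE ei.
Qed.

Section Standardization.

Variables (n k : nat) (D : 'M[tile]_(k, n)) (u : 'I_k -> 'I_n) (i i' : 'I_k).
Hypotheses (pivD : pivot_columns D u) (ei : i' = i.+1 :> nat).
Hypothesis lt_u : u i < u i'.
Variables (E : 'M[tile]_n) (w v : 'S_n) (le_kn : k <= n).
Hypotheses (fppE : fpp w v E) (eD : D = rowsub (widen_ord le_kn) E).

Let I := widen_ord le_kn i.
Let I' := widen_ord le_kn i'.
Let js := jstar u i i' D.
Let D' := st u i i' D.

Lemma restrictE r j : D r j = E (widen_ord le_kn r) j.
Proof. by rewrite eD mxE. Qed.

Lemma pivot_restrict r : w (widen_ord le_kn r) = u r.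
Proof.
by apply/pivD; rewrite restrictE (rothe_pivot (fpp_rothe fppE)).
Qed.

Let wI : w I = u i. Proof. exact: pivot_restrict. Qed.
Let wI' : w I' = u i'. Proof. exact: pivot_restrict. Qed.

Lemma jstar_le : js <= n.
Proof. by rewrite -[leqRHS]size_enum_ord find_size. Qed.

Lemma jstar_at (j : 'I_n) : j = js :> nat ->
  [/\ u i' <= j, D i j = Cross & is_node (D i' j)].
Proof.
move=> ej; have ltjs : js < n by rewrite -ej.
have := @nth_find _ j (fun j : 'I_n =>
  [&& u i' <= j, D i j == Cross & D i' j \in [:: Elbow; Pivot]]) (enum 'I_n).
rewrite has_find size_enum_ord -/(jstar u i i' D) -/js ltjs => /(_ isT).
rewrite -ej nth_ord_enum => /and3P[le /eqP tC tn]; split=> //.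
by move: tn; rewrite -is_nodeE !inE orbC.
Qed.

Lemma before_jstar (j : 'I_n) : u i' <= j -> j < js -> D i j = Cross ->
  ~~ is_node (D i' j).
Proof.
move=> le lt tC; have := before_find j lt.
rewrite nth_ord_enum le tC eqxx /= => /negbT; apply: contra.
by rewrite -is_nodeE !inE orbC.
Qed.

Lemma jstar_ge : u i' <= js.
Proof.
have := jstar_le; rewrite leq_eqVlt => /orP[/eqP->|ltjs]; first exact: ltnW.
by have [] := @jstar_at (Ordinal ltjs) erefl.
Qed.

Let ne_i : (i == i') = false. Proof. by rewrite -val_eqE /= ei ltn_eqF. Qed.

Lemma st_upper j : D' i j =
  if j == u i then Vertical
  else if (j <= u i') || (js <= j) then D i' j else D i j.
Proof. by rewrite mxE eqxx ne_i /= tpermL -/js. Qed.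

Lemma st_lower j : D' i' j =
  if j == u i' then Horizontal
  else if (j == js :> nat) && (u i' < js) then Elbow
  else if (j <= u i') || (js <= j) then D i j else D i' j.
Proof. by rewrite mxE eqxx [i' == i]eq_sym ne_i /= tpermR -/js. Qed.

Lemma st_other r j : r != i -> r != i' -> D' r j = D r j.
Proof.
move=> nri nri'; rewrite mxE (negbTE nri) (negbTE nri') /= tpermD 1?eq_sym //.
by case: ifP.
Qed.

Lemma st_pivot : exists u', pivot_columns D' u'.
Proof.
exists (fun r => if r == i then u i' else if r == i' then u i else u r) => r j.
have Di := iffLR (pivD i j); have Di' := iffLR (pivD i' j).
have [->|nri] := eqVneq r i.
  rewrite st_upper; case: eqP => [->|ne].
    by split=> // eu; move: lt_u; rewrite -eu ltnn.
  case: ifP => [_|nle]; first exact: pivD.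
  by split=> [/Di //|ej]; move: nle; rewrite ej leqnn.
have [->|nri'] := eqVneq r i'; last by rewrite st_other.
rewrite st_lower; case: eqP => [->|ne].
  by split=> // eu; move: lt_u; rewrite eu ltnn.
case: ifP => [/andP[/eqP ej lt]|nj].
  by split=> // eu; move: lt; rewrite -ej eu ltnNge (ltnW lt_u).
case: ifP => [_|nle]; first exact: pivD.
by split=> [/Di' //|ej]; move: nle; rewrite ej (ltnW lt_u).
Qed.

Lemma st_two_rows (V : nat -> nat -> bool) (T : nat -> bool) :
  (forall j, V k j = false) ->
  (forall r : 'I_k, i' < r -> row_flow (D r) (V r.+1) (V r)) ->
  (exists M, row_flow (D i') (V i'.+1) M /\ row_flow (D i) M T) <->
  (exists M, row_flow (D' i') (V i'.+1) M /\ row_flow (D' i) M T).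
Proof.
move=> Vk rowV; have le_js := jstar_ge.
have eI : I' = I.+1 :> nat by [].
have upper (j : 'I_n) : js <= j -> ~~ is_node (D i j).
  move=> lej; have ltjs : js < n by apply: leq_ltn_trans lej (ltn_ord j).
  have [ge tC tn] := @jstar_at (Ordinal ltjs) erefl.
  rewrite !restrictE in tC tn *.
  by apply: (no_node_after_cross fppE eI) tC tn _; rewrite ?wI'.
apply: (@two_rows _ _ _ _ _ (u i') js) => //.
- exact: jstar_le.
- move=> j ltj; have nL : ~~ is_node (D i' j).
    rewrite restrictE; case: (tileP fppE I' j); rewrite ?wI' // => *; try by lia.
    by subst; rewrite ltnn in ltj.
  have neb : j != u i' by rewrite -val_eqE ltn_eqF.
  split=> //; first by rewrite st_upper (ltnW ltj); case: ifP.
  by rewrite st_lower (negbTE neb) ltn_eqF ?(ltnW ltj) //; apply: leq_trans ltj le_js.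
- split; first by apply/pivD.
    by rewrite st_upper leqnn -val_eqE gtn_eqF //; apply/pivD.
  by rewrite st_lower eqxx.
- move=> ltb; have := @before_jstar (u i') (leqnn _) ltb.
  rewrite (iffRL (pivD i' _) erefl) restrictE.
  case: (tileP fppE I (u i')) => [e|? ?|lt ?|? lt|? ?|? ?] //; last by move=> /(_ erefl).
  + by move: lt_u; rewrite e wI ltnn.
  + by move: lt_u; rewrite -wI => ?; lia.
  + by move: lt; rewrite -wI' permK /= ei; lia.
  by move: lt_u; rewrite -wI => ?; lia.
- move=> j /andP[ltb ltjs].
  have neb : j != u i' by rewrite -val_eqE gtn_eqF.
  have nea : j != u i by rewrite -val_eqE gtn_eqF // (ltn_trans lt_u ltb).
  have nodeE r : w (widen_ord le_kn r) = u r -> j != u r -> is_node (D r j) -> D r j = Elbow.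
    move=> wr ne; rewrite restrictE; case: (tileP fppE _ j) => // e.
    by rewrite e wr eqxx in ne.
  split.
  + by rewrite st_lower (negbTE neb) ltn_eqF //= leqNgt ltb leqNgt ltjs.
  + by rewrite st_upper (negbTE nea) leqNgt ltb leqNgt ltjs.
  + move=> nL; have LE := nodeE i' wI' neb nL; split=> //.
    have := @before_jstar j (ltnW ltb) ltjs; rewrite nL.
    move: LE; rewrite !restrictE; case: (tileP fppE I' j) => // lt _ _.
    case: (tileP fppE I j) => [e|? ?|? ?|? ?|? ?|? ?] //; try by lia.
    * by rewrite e wI eqxx in nea.
    * by move: ltb lt_u; rewrite -wI => ? ?; lia.
    by move=> /(_ erefl).
  exact: nodeE wI nea.
- move=> j ej ltb; have [_ tC tn] := jstar_at ej.
  have neb : j != u i' by rewrite -val_eqE /= ej gtn_eqF.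
  have nea : j != u i by rewrite -val_eqE /= ej gtn_eqF // (ltn_trans lt_u ltb).
  have LE : D i' j = Elbow.
    move: tn; rewrite restrictE; case: (tileP fppE I' j) => // e.
    by rewrite e wI' eqxx in neb.
  split=> //; first by rewrite st_lower (negbTE neb) ej eqxx ltb.
  by rewrite st_upper (negbTE nea) ej leqnn orbT.
- move=> j ltj; have ltb : u i' < j by apply: leq_ltn_trans le_js ltj.
  have neb : j != u i' by rewrite -val_eqE gtn_eqF.
  have nea : j != u i by rewrite -val_eqE gtn_eqF // (ltn_trans lt_u ltb).
  split; last by rewrite st_upper (negbTE nea) (ltnW ltj) orbT.
  by rewrite st_lower (negbTE neb) gtn_eqF //= (ltnW ltj) orbT upper // ltnW.
move=> y z /andP[ltb lty] nL nU Sy ltyz nz noz.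
rewrite !restrictE in nL nU nz.
have tC : E I' y = Cross.
  have nea : y != u i by rewrite -val_eqE gtn_eqF // (ltn_trans lt_u ltb).
  move: nU nL; case: (tileP fppE I y) => [e|//|//|//|//|lt _] _.
    by rewrite e wI eqxx in nea.
  case: (tileP fppE I' y) => [//|_|lt'|_|//|//]; rewrite ?wI' => *; try by lia.
apply: (@cross_flow _ _ _ _ fppE k i'.+1 V le_kn Vk _ I' y z) => //.
- move=> r /andP[ltr ltrk].
  apply: row_flow_ext (rowV (Ordinal ltrk) ltr) => j.
  by rewrite restrictE; congr (E _ _); apply: val_inj.
- exact: ltn_ord i'.
by move=> l /noz; rewrite restrictE.
Qed.

Lemma st_flow J : flow D J <-> flow D' J.
Proof.
split.
  apply: (flow_replace ei st_other) => V Vk rowV.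
  by rewrite (st_two_rows _ Vk rowV).
apply: (flow_replace ei) => [r j nri nri'|V Vk rowV]; first by rewrite st_other.
rewrite (st_two_rows _ Vk) // => r ltr; apply: row_flow_ext (rowV r ltr) => j.
rewrite st_other // -val_eqE gtn_eqF //.
by apply: ltn_trans ltr; rewrite ei.
Qed.

End Standardization.

Theorem theorem4p34 (n k : nat) (D : 'M[tile]_(k, n)) (u : 'I_k -> 'I_n)
    (i i' : 'I_k) :
  partial_fpp D ->
  pivot_columns D u ->
  i' = i.+1 :> nat ->
  (u i < u i')%N ->
  sink_sets D = sink_sets (st u i i' D).
Proof.
move=> [w [v [E [le_kn [fppE eD]]]]] pivD ei lt_u.
have [u' pivD'] := st_pivot pivD ei lt_u.
apply/predeqP => J; rewrite (sink_sets_flow _ pivD) (sink_sets_flow _ pivD').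
exact: (st_flow pivD ei lt_u fppE eD).
Qed.
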